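(* Let $S$ be the $\Bbbk$-algebra generated by $x,y,t$ subject to the relations $$xy=-yx,\qquad tx=yt,\qquad ty=xt$$ (that is, $S=V_2[t;\sigma]$, where $V_2=\Bbbk_{-1}[x,y]=\Bbbk\langle x,y\mid xy+yx=0\rangle$ and $\sigma\in\operatorname{Aut}(V_2)$ is given by $\sigma(x)=y$, $\sigma(y)=x$). Then $\operatorname{Aut}(S)\cong(\Bbbk^\times)^2\rtimes\langle\tau\rangle$, where $\tau$ is the automorphism $x\leftrightarrow y$ (fixing $t$), and $(a,b)\in(\Bbbk^\times)^2$ corresponds to the automorphism $x\mapsto ax$, $y\mapsto ay$, $t\mapsto bt$.
   Context: $\Bbbk$ is an algebraically closed field of characteristic zero. $\operatorname{Aut}(S)$ is the group of $\Bbbk$-algebra automorphisms of $S$. For an algebra $A$ and $\sigma\in\operatorname{Aut}(A)$, the Ore extension $A[t;\sigma]$ is generated by $A$ and $t$ with the rule $ta=\sigma(a)t$ for all $a\in A$. $\langle\tau\rangle$ is the group of order two generated by $\tau$. *)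

(* Defs.v *)
From HB Require Import structures.
From mathcomp Require Import all_boot all_algebra.
From mathcomp Require Import boolp.
From mathcomp Require Import finmap monalg.

Set Implicit Arguments.
Unset Strict Implicit.
Unset Printing Implicit Defensive.

Import GRing.Theory.

Local Open Scope ring_scope.
Local Open Scope quotient_scope.

Section FreeAlgebra.
Variables (k : fieldType) (I : choiceType).

Local Notation MA := {malg k[{fmonom I}]}.

Fact malg_scaleAr (c : k) (f g : MA) : c *: (f * g) = f * (c *: g).
Proof.
apply/malgP => m; rewrite (mcoeffZ c (f * g)).
rewrite [RHS](mcoeffMlw m (fsubset_refl _) (msuppZ_le c g)).
rewrite (mcoeffMl f g) mulr_sumr; apply: eq_bigr => m1 _.
rewrite mulr_sumr; apply: eq_bigr => m2 _.
by rewrite (mcoeffZ c g) mulrnAr mulrCA.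
Qed.

Fact malg_ind (P : MA -> Prop) :
  P 1 -> (forall a b, P a -> P b -> P (a + b)) ->
  (forall c a, P a -> P (c *: a)) ->
  (forall i a, P a -> P (mkmalgU (fmu i) 1 * a)) -> forall a, P a.
Proof.
move=> P1 PD PZ PM a; rewrite (monalgE a).
have Pw (s : seq I) : P (mkmalgU (FMonom s) 1).
  elim: s => [|i s IHs]; first by rewrite -fmoneE; exact: P1.
  have -> : FMonom (i :: s) = mmul (fmu i) (FMonom s).
    by apply/eqP; rewrite -val_eqE /= fmM fmU.
  rewrite -[X in mkmalgU _ X](mulr1 1) -fgmulUU; exact: PM.
apply: (big_ind P) => [|//|m _].
  by have := PZ 0 _ P1; rewrite scale0r.
have -> : mkmalgU m (mcoeff m a) = mcoeff m a *: mkmalgU m 1.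
  apply/malgP => m'; rewrite (mcoeffZ (mcoeff m a)).
  by rewrite [RHS]/= [in RHS]mcoeffU [LHS]mcoeffU mulrnAr mulr1.
by apply: PZ; case: m.
Qed.

(* Monoid algebra of the free monoid on I. The alias is needed because the
   library makes {malg k[M]} an algType only for commutative M. *)
Definition free_alg := MA.
HB.instance Definition _ := GRing.Lalgebra.on free_alg.
HB.instance Definition _ :=
  GRing.Lalgebra_isAlgebra.Build k free_alg malg_scaleAr.

Definition letter (i : I) : free_alg := mkmalgU (fmu i) 1.

Lemma free_ind (P : free_alg -> Prop) :
  P 1 -> (forall a b, P a -> P b -> P (a + b)) ->
  (forall c a, P a -> P (c *: a)) ->
  (forall i a, P a -> P (letter i * a)) -> forall a, P a.
Proof. exact: malg_ind. Qed.

Lemma free_ext (B : algType k) (f g : {lrmorphism free_alg -> B}) :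
  (forall i, f (letter i) = g (letter i)) -> f =1 g.
Proof.
move=> fg; apply: free_ind => [|a b fa fb|c a fa|i a fa].
- by rewrite !rmorph1.
- by rewrite !rmorphD /= fa fb.
- by rewrite !linearZ_LR /= fa.
- by rewrite !rmorphM /= fa fg.
Qed.

Section Lift.
Variables (B : algType k) (b : I -> B).

Let evalw (m : {fmonom I}) : B := \prod_(i <- (m : seq I)) b i.

Fact evalw_mmorph : mmorphism evalw.
Proof.
split=> [m1 m2|]; first by rewrite /evalw fmM big_cat.
by rewrite /evalw fm1 big_nil.
Qed.
HB.instance Definition _ :=
  monalg.isMultiplicative.Build {fmonom I} B evalw evalw_mmorph.

Let eval (f : {malg k[{fmonom I}]}) : B := mmap (in_alg B) evalw f.

Lemma free_lift :
  exists f : {lrmorphism free_alg -> B}, forall i, f (letter i) = b i.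
Proof.
have [eM e1] : multiplicative eval.
  by apply: commr_mmap_is_multiplicative => g m m';
     rewrite /GRing.comm /= -scalerAl -scalerAr mul1r mulr1.
have elin : linear (eval : free_alg -> B).
  move=> c f g; rewrite /eval mmapD mmapZ /=.
  by rewrite -scalerAl mul1r.
pose L := GRing.isLinear.Build k free_alg B _ eval elin.
pose M := GRing.isMonoidMorphism.Build free_alg B eval (e1, eM).
pose f : {lrmorphism free_alg -> B} := HB.pack (eval : free_alg -> B) L M.
exists f => i; rewrite -[LHS]/(eval (mkmalgU (fmu i) 1)) /eval mmapU /=.
by rewrite scale1r mul1r /evalw fmU big_seq1.
Qed.

End Lift.
End FreeAlgebra.

(* Two-sided ideal of R generated by G. *)
Inductive in_ideal (R : nzRingType) (G : R -> Prop) : R -> Prop :=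
| ideal_gen r of G r : in_ideal G r
| ideal_0 : in_ideal G 0
| ideal_D r s of in_ideal G r & in_ideal G s : in_ideal G (r + s)
| ideal_Ml a r of in_ideal G r : in_ideal G (a * r)
| ideal_Mr r a of in_ideal G r : in_ideal G (r * a).

Section QuotientAlgebra.
Variables (k : fieldType) (A : algType k) (G : A -> Prop).

Definition ideal_pred : {pred A} := [pred f | `[< in_ideal G f >]].

Fact ideal_zmod : zmod_closed ideal_pred.
Proof.
split; first exact/asboolP/ideal_0.
move=> f g /asboolP If /asboolP Ig; apply/asboolP.
by rewrite -mulN1r; apply: ideal_D => //; apply: ideal_Ml.
Qed.
HB.instance Definition _ := GRing.isZmodClosed.Build A ideal_pred ideal_zmod.

(* algType excludes the zero ring, so the ideal has to be proper. *)
Definition quot_alg of ~ in_ideal G 1 := Quotient.quot ideal_pred.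

Hypothesis G1 : ~ in_ideal G 1.
Local Notation Q := (quot_alg G1).

HB.instance Definition _ := GRing.Zmodule.on Q.

Definition proj (f : A) : Q := \pi_(Quotient.quot ideal_pred) f.

Lemma projP f g : proj f = proj g <-> in_ideal G (f - g).
Proof.
rewrite /proj (rwP eqP) -(Quotient.idealrBE (ideal_pred : zmodClosed A)).
by split=> /asboolP.
Qed.

Lemma proj_repr (u : Q) : proj (repr (u : Quotient.quot ideal_pred)) = u.
Proof. exact: reprK. Qed.

Lemma proj_surj (u : Q) : exists f, u = proj f.
Proof. by eexists; rewrite -[LHS]proj_repr. Qed.

Fact projB : {morph proj : f g / f - g}.
Proof. by move=> f g; rewrite /proj raddfB. Qed.

Fact projD : {morph proj : f g / f + g}.
Proof. by move=> f g; rewrite /proj raddfD. Qed.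

Let rep (u : Q) : A := repr (u : Quotient.quot ideal_pred).
Definition quot_mul (u v : Q) : Q := proj (rep u * rep v).
Definition quot_scale (c : k) (u : Q) : Q := proj (c *: rep u).

Fact rep_proj f : in_ideal G (rep (proj f) - f).
Proof. by apply/projP; exact: proj_repr. Qed.

Fact proj_mul f g : quot_mul (proj f) (proj g) = proj (f * g).
Proof.
apply/projP; have := rep_proj f; have := rep_proj g.
set f' := rep _; set g' := rep _ => Ig If.
have -> : g' * f' - f * g = (g' - f) * f' + f * (f' - g).
  by rewrite mulrBl mulrBr addrA subrK.
by apply: ideal_D; [apply: ideal_Mr | apply: ideal_Ml].
Qed.

Fact proj_scale c f : quot_scale c (proj f) = proj (c *: f).
Proof.
apply/projP; rewrite -scalerBr -[_ - f]mul1r scalerAl.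
by apply: ideal_Ml; exact: rep_proj.
Qed.

Fact quot_mulA : associative quot_mul.
Proof.
move=> u v w; rewrite -(proj_repr u) -(proj_repr v) -(proj_repr w).
by rewrite !proj_mul mulrA.
Qed.

Fact quot_mul1 : left_id (proj 1) quot_mul.
Proof. by move=> u; rewrite -(proj_repr u) proj_mul mul1r. Qed.

Fact quot_1mul : right_id (proj 1) quot_mul.
Proof. by move=> u; rewrite -(proj_repr u) proj_mul mulr1. Qed.

Fact quot_mulDl : left_distributive quot_mul +%R.
Proof.
move=> u v w; rewrite -(proj_repr u) -(proj_repr v) -(proj_repr w).
by rewrite -projD !proj_mul -projD mulrDl.
Qed.

Fact quot_mulDr : right_distributive quot_mul +%R.
Proof.
move=> u v w; rewrite -(proj_repr u) -(proj_repr v) -(proj_repr w).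
by rewrite -projD !proj_mul -projD mulrDr.
Qed.

Fact quot_1_neq0 : proj 1 != 0.
Proof.
apply/eqP; have -> : 0 = proj 0 by rewrite /proj raddf0.
by move/projP; rewrite subr0.
Qed.

HB.instance Definition _ := GRing.Zmodule_isNzRing.Build Q
  quot_mulA quot_mul1 quot_1mul quot_mulDl quot_mulDr quot_1_neq0.

Fact quot_scaleA a b u : quot_scale a (quot_scale b u) = quot_scale (a * b) u.
Proof. by rewrite -(proj_repr u) !proj_scale scalerA. Qed.

Fact quot_scale1 : left_id 1 quot_scale.
Proof. by move=> u; rewrite -(proj_repr u) proj_scale scale1r. Qed.

Fact quot_scaleDr : right_distributive quot_scale +%R.
Proof.
move=> c u v; rewrite -(proj_repr u) -(proj_repr v).
by rewrite -projD !proj_scale -projD scalerDr.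
Qed.

Fact quot_scaleDl u : {morph quot_scale^~ u : a b / a + b}.
Proof. by move=> a b; rewrite -(proj_repr u) !proj_scale -projD scalerDl. Qed.

HB.instance Definition _ := GRing.Zmodule_isLmodule.Build k Q
  quot_scaleA quot_scale1 quot_scaleDr quot_scaleDl.

Fact proj_linear : linear proj.
Proof. by move=> c f g; rewrite projD -proj_scale. Qed.

Fact proj_monoid : monoid_morphism proj.
Proof. by split=> // f g; rewrite -proj_mul. Qed.

HB.instance Definition _ := GRing.isLinear.Build k A Q _ proj proj_linear.
HB.instance Definition _ := GRing.isMonoidMorphism.Build A Q proj proj_monoid.

Fact quot_scaleAl (c : k) (u v : Q) : c *: (u * v) = (c *: u) * v.
Proof.
have [f ->] := proj_surj u; have [g ->] := proj_surj v.
by rewrite -rmorphM -!linearZ -rmorphM /= scalerAl.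
Qed.
HB.instance Definition _ := GRing.Lmodule_isLalgebra.Build k Q quot_scaleAl.

Fact quot_scaleAr (c : k) (u v : Q) : c *: (u * v) = u * (c *: v).
Proof.
have [f ->] := proj_surj u; have [g ->] := proj_surj v.
by rewrite -rmorphM -!linearZ -rmorphM /= scalerAr.
Qed.
HB.instance Definition _ := GRing.Lalgebra_isAlgebra.Build k Q quot_scaleAr.

Lemma quot_lift (B : algType k) (h : {lrmorphism A -> B}) :
  (forall r, G r -> h r = 0) ->
  exists h' : {lrmorphism Q -> B}, forall f, h' (proj f) = h f.
Proof.
move=> hG; have hI f : in_ideal G f -> h f = 0.
  elim=> {f} [||f g _ hf _ hg|a f _ hf|f a _ hf] //.
  - exact: raddf0.
  - by rewrite rmorphD /= hf hg addr0.
  - by rewrite rmorphM /= hf mulr0.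
  - by rewrite rmorphM /= hf mul0r.
pose l (u : Q) := h (rep u).
have lE f : l (proj f) = h f.
  by apply/eqP; rewrite -subr_eq0 -rmorphB; apply/eqP/hI/rep_proj.
have llin : linear l.
  move=> c u v; have [f ->] := proj_surj u; have [g ->] := proj_surj v.
  by rewrite -linearP !lE linearP.
have lmul : monoid_morphism l.
  split=> [|u v]; first by rewrite -(rmorph1 proj) lE rmorph1.
  have [f ->] := proj_surj u; have [g ->] := proj_surj v.
  by rewrite -rmorphM !lE rmorphM.
pose L := GRing.isLinear.Build k Q B _ l llin.
pose M := GRing.isMonoidMorphism.Build Q B l lmul.
by exists (HB.pack l L M : {lrmorphism Q -> B}).
Qed.

End QuotientAlgebra.

Section Relators.
Variables (k : fieldType) (A : algType k) (x y t : A).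

Inductive relator : A -> Prop :=
| rel_xy : relator (x * y - - (y * x))
| rel_tx : relator (t * x - y * t)
| rel_ty : relator (t * y - x * t).

Lemma relator_eq0 (B : algType k) (h : {lrmorphism A -> B}) :
  h x * h y = - (h y * h x) -> h t * h x = h y * h t ->
  h t * h y = h x * h t -> forall r, relator r -> h r = 0.
Proof.
move=> hxy htx hty r [];
  by rewrite rmorphB ?rmorphN !rmorphM /= ?hxy ?htx ?hty subrr.
Qed.

Lemma relator_not1 (e : {lrmorphism A -> k^o}) :
  e x = 0 -> e y = 0 -> e t = 0 -> ~ in_ideal relator 1.
Proof.
move=> x0 y0 t0; suff eI f : in_ideal relator f -> e f = 0.
  by move/eI/eqP; rewrite rmorph1 oner_eq0.
elim=> {f} [||f g _ ef _ eg|a f _ ef|f a _ ef].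
- by apply: relator_eq0; rewrite ?x0 ?y0 ?t0 !mulr0 ?oppr0.
- exact: raddf0.
- by rewrite rmorphD /= ef eg addr0.
- by rewrite rmorphM /= ef mulr0.
- by rewrite rmorphM /= ef mul0r.
Qed.

End Relators.

Section AlgebraS.
Variable k : fieldType.

(* Free generators mapping to x, y, t. *)
Definition X0 : free_alg k 'I_3 := letter k (@Ordinal 3 0 isT).
Definition X1 : free_alg k 'I_3 := letter k (@Ordinal 3 1 isT).
Definition X2 : free_alg k 'I_3 := letter k (@Ordinal 3 2 isT).

Fact relator_proper : ~ in_ideal (relator X0 X1 X2) 1.
Proof.
have [e e0] := free_lift (fun _ : 'I_3 => 0 : k^o).
exact: (relator_not1 (e := e) (e0 _) (e0 _) (e0 _)).
Qed.

Lemma free3_ext (B : algType k) (f g : {lrmorphism free_alg k 'I_3 -> B}) :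
  f X0 = g X0 -> f X1 = g X1 -> f X2 = g X2 -> f =1 g.
Proof.
move=> f0 f1 f2; apply: free_ext => i.
have [-> | -> | ->] : [\/ i = @Ordinal 3 0 isT, i = @Ordinal 3 1 isT
                       | i = @Ordinal 3 2 isT].
- by case: i => [[|[|[|m]]] lti] //; [constructor 1 | constructor 2 | constructor 3]; apply: val_inj.
- exact: f0.
- exact: f1.
- exact: f2.
Qed.

Definition algS := quot_alg relator_proper.
HB.instance Definition _ := GRing.Algebra.on algS.

Definition Sx : algS := proj relator_proper X0.
Definition Sy : algS := proj relator_proper X1.
Definition St : algS := proj relator_proper X2.

Lemma S_rel_xy : Sx * Sy = - (Sy * Sx).
Proof.
rewrite -!(rmorphM (proj relator_proper)) -(rmorphN (proj relator_proper)).
by apply/projP/ideal_gen; constructor.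
Qed.

Lemma S_rel_tx : St * Sx = Sy * St.
Proof.
rewrite -!(rmorphM (proj relator_proper)).
by apply/projP/ideal_gen; constructor.
Qed.

Lemma S_rel_ty : St * Sy = Sx * St.
Proof.
rewrite -!(rmorphM (proj relator_proper)).
by apply/projP/ideal_gen; constructor.
Qed.

Lemma S_lift (B : algType k) (x y t : B) :
  x * y = - (y * x) -> t * x = y * t -> t * y = x * t ->
  exists f : {lrmorphism algS -> B}, [/\ f Sx = x, f Sy = y & f St = t].
Proof.
move=> xy tx ty.
have [h hE] := free_lift (fun i : 'I_3 => nth 0 [:: x; y; t] i).
have [hx hy ht] : [/\ h X0 = x, h X1 = y & h X2 = t] by split; exact: hE.
rewrite -{}hx -{}hy -{}ht in xy tx ty *.
have [|f fE] := quot_lift relator_proper (h := h).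
  exact: (relator_eq0 (h := h)).
by exists f; split; exact: fE.
Qed.

Lemma S_ext (B : algType k) (f g : {lrmorphism algS -> B}) :
  f Sx = g Sx -> f Sy = g Sy -> f St = g St -> f =1 g.
Proof.
move=> fx fy ft u.
have [a ->] := proj_surj (u : quot_alg (@relator_proper)).
pose p : {lrmorphism free_alg k 'I_3 -> algS} := proj relator_proper.
exact: (free3_ext (f := f \o p) (g := g \o p) fx fy ft a).
Qed.

End AlgebraS.

Section AlgebraAutomorphisms.
Variables (k : fieldType) (A : algType k).

Definition is_alg_aut (f : A -> A) : Prop :=
  [/\ linear f, GRing.monoid_morphism f & bijective f].

(* The group law below is composition: (f * g) u = f (g u). *)
Record alg_aut := AlgAut { aut_fun :> A -> A; _ : `[< is_alg_aut aut_fun >] }.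
HB.instance Definition _ := [isSub for aut_fun].
HB.instance Definition _ := [Choice of alg_aut by <:].

Lemma alg_autP (f : alg_aut) : is_alg_aut f.
Proof. exact/asboolP/(valP f). Qed.

Lemma alg_aut_ext (f g : alg_aut) : f =1 g -> f = g.
Proof. by move=> fg; apply/val_inj/funext. Qed.

Fact aut_id_subproof : `[< is_alg_aut (@id A) >].
Proof. by apply/asboolP; split=> //; exists id. Qed.

Fact aut_comp_subproof (f g : alg_aut) : `[< is_alg_aut (f \o g) >].
Proof.
have [fL [f1 fM] fB] := alg_autP f; have [gL [g1 gM] gB] := alg_autP g.
apply/asboolP; split; last exact: bij_comp.
- by move=> c u v; rewrite /= gL fL.
- by split=> [|u v] /=; rewrite ?g1 ?f1 // gM fM.
Qed.

Fact aut_has_inv (f : alg_aut) : exists g : alg_aut, cancel f g /\ cancel g f.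
Proof.
have [fL [f1 fM] [g fK gK]] := alg_autP f.
have gP : `[< is_alg_aut g >].
  apply/asboolP; split; last by exists f.
  - by move=> c u v; rewrite -{1}(gK u) -{1}(gK v) -fL fK.
  - split=> [|u v]; first by rewrite -[X in g X]f1 fK.
    by rewrite -{1}(gK u) -{1}(gK v) -fM fK.
by exists (AlgAut gP).
Qed.

Definition aut_one := AlgAut aut_id_subproof.
Definition aut_mul (f g : alg_aut) := AlgAut (aut_comp_subproof f g).
Definition aut_inv (f : alg_aut) : alg_aut := projT1 (cid (aut_has_inv f)).

Fact aut_mulA : associative aut_mul.
Proof. by move=> f g h; apply: alg_aut_ext. Qed.
Fact aut_mul1 : left_id aut_one aut_mul.
Proof. by move=> f; apply: alg_aut_ext. Qed.
Fact aut_1mul : right_id aut_one aut_mul.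
Proof. by move=> f; apply: alg_aut_ext. Qed.
Fact aut_mulV : left_inverse aut_one aut_inv aut_mul.
Proof.
move=> f; apply: alg_aut_ext => u; rewrite /aut_inv /=.
by case: cid => g [/= fK _]; exact: fK.
Qed.
Fact aut_Vmul : right_inverse aut_one aut_inv aut_mul.
Proof.
move=> f; apply: alg_aut_ext => u; rewrite /aut_inv /=.
by case: cid => g [/= _ gK]; exact: gK.
Qed.
HB.instance Definition _ :=
  isGroup.Build alg_aut aut_mulA aut_mul1 aut_1mul aut_mulV aut_Vmul.

End AlgebraAutomorphisms.

(* R^*; the library's {unit R} is restricted to finite rings. *)
Section UnitGroup.
Variable R : unitRingType.

Record units := Units { unit_val :> R; _ : unit_val \is a GRing.unit }.
HB.instance Definition _ := [isSub for unit_val].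
HB.instance Definition _ := [Choice of units by <:].

Fact unit_mul_subproof (a b : units) : unit_val a * unit_val b \is a GRing.unit.
Proof. by rewrite unitrMl; [exact: (valP a) | exact: (valP b)]. Qed.
Fact unit_inv_subproof (a : units) : (unit_val a)^-1 \is a GRing.unit.
Proof. by rewrite unitrV; exact: (valP a). Qed.

Definition units_one := Units (unitr1 R).
Definition units_mul (a b : units) := Units (unit_mul_subproof a b).
Definition units_inv (a : units) := Units (unit_inv_subproof a).

Fact units_mulA : associative units_mul.
Proof. by move=> a b c; apply/val_inj; exact: mulrA. Qed.
Fact units_mul1 : left_id units_one units_mul.
Proof. by move=> a; apply/val_inj; exact: mul1r. Qed.
Fact units_1mul : right_id units_one units_mul.
Proof. by move=> a; apply/val_inj; exact: mulr1. Qed.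
Fact units_mulV : left_inverse units_one units_inv units_mul.
Proof. by move=> a; apply/val_inj/mulVr/(valP a). Qed.
Fact units_Vmul : right_inverse units_one units_inv units_mul.
Proof. by move=> a; apply/val_inj/mulrV/(valP a). Qed.
HB.instance Definition _ :=
  isGroup.Build units units_mulA units_mul1 units_1mul units_mulV units_Vmul.

End UnitGroup.

Local Open Scope group_scope.

Section CyclicSubgroup.
Variables (G : groupType) (g : G).

Definition cyclic_pred : pred G :=
  fun h => `[< exists n : nat, h = g ^+ n \/ h = g ^- n >].

Record cyclic_grp := CyclicGrp { cyc_val :> G; _ : cyclic_pred cyc_val }.
HB.instance Definition _ := [isSub for cyc_val].
HB.instance Definition _ := [Choice of cyclic_grp by <:].

Fact cyclic_closed : group_closed cyclic_pred.
Proof.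
have VE (h : G) : h \in cyclic_pred -> h^-1 \in cyclic_pred.
  by move=> /asboolP[n nE]; apply/asboolP; exists n; case: nE => ->;
     rewrite ?invgK; [right | left].
have gM n h : h \in cyclic_pred -> g ^+ n * h \in cyclic_pred.
  move=> /asboolP[m [->|->]]; apply/asboolP.
    by exists (n + m)%N; left; rewrite expgnDr.
  have [mn|/ltnW nm] := leqP m n.
    by exists (n - m)%N; left; rewrite -{1}(subnK mn) expgnDr mulgK.
  by exists (m - n)%N; right; rewrite -{1}(subnK nm) expgnDr invgM mulgA mulgV mul1g.
split=> [|u v]; first by apply/asboolP; exists 0%N; left.
move=> /asboolP[n [->|->]] Cv; first exact/gM/VE.
have -> : g ^- n * v^-1 = (g ^+ n * v)^-1.
  rewrite invgM; case/asboolP: Cv => m [->|->]; rewrite ?invgK.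
    by rewrite -!invgM -!expgnDr addnC.
  exact/(@commute_sym G)/(@commuteV G)/commuteX2.
exact/VE/gM.
Qed.
HB.instance Definition _ :=
  SubChoice_isSubGroup.Build G cyclic_pred cyclic_grp cyclic_closed.

End CyclicSubgroup.

Section SemidirectProduct.

(* Actions of H on N by group automorphisms (bijectivity follows from gact1, gactM). *)
Record group_action (H N : groupType) := GroupAction {
  gact :> H -> N -> N;
  gact1 : forall n, gact 1 n = n;
  gactM : forall h h' n, gact (h * h') n = gact h (gact h' n);
  gact_morph : forall h n n', gact h (n * n') = gact h n * gact h n'
}.

Record semidirect (H N : groupType) (theta : group_action H N) :=
  Semidirect { sd_left : N; sd_right : H }.

Variables (H N : groupType) (theta : group_action H N).
Local Notation sd := (semidirect theta).
Local Notation Sd := (@Semidirect H N theta).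

Definition semidirect_pair (u : sd) := (sd_left u, sd_right u).
Fact semidirect_pairK :
  cancel semidirect_pair (fun p => Sd p.1 p.2).
Proof. by case. Qed.
HB.instance Definition _ := Choice.copy sd (can_type semidirect_pairK).

Definition sd_one : sd := Sd 1 1.
Definition sd_mul (u v : sd) :=
  Sd (sd_left u * theta (sd_right u) (sd_left v))
             (sd_right u * sd_right v).
Definition sd_inv (u : sd) :=
  Sd (theta (sd_right u)^-1 (sd_left u)^-1) (sd_right u)^-1.

Fact gact_1r h : theta h 1 = 1.
Proof.
by apply: (mulgI (theta h 1)); rewrite -gact_morph !mulg1.
Qed.

Fact sd_mulA : associative sd_mul.
Proof. by case=> [n h] [n' h'] [n'' h'']; rewrite /sd_mul /= gact_morph gactM !mulgA. Qed.
Fact sd_mul1 : left_id sd_one sd_mul.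
Proof. by case=> n h; rewrite /sd_mul /= gact1 !mul1g. Qed.
Fact sd_1mul : right_id sd_one sd_mul.
Proof. by case=> n h; rewrite /sd_mul /= gact_1r !mulg1. Qed.
Fact sd_mulV : left_inverse sd_one sd_inv sd_mul.
Proof. by case=> n h; rewrite /sd_mul /= -gact_morph !mulVg gact_1r. Qed.
Fact sd_Vmul : right_inverse sd_one sd_inv sd_mul.
Proof. by case=> n h; rewrite /sd_mul /= -gactM !mulgV gact1 mulgV. Qed.
HB.instance Definition _ :=
  isGroup.Build sd sd_mulA sd_mul1 sd_1mul sd_mulV sd_Vmul.

End SemidirectProduct.

Arguments Semidirect {H N} theta.

(* Main.v *)
Require Import Defs.
From HB Require Import structures.
From mathcomp Require Import all_boot all_algebra.
From mathcomp Require Import boolp.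

Set Implicit Arguments.
Unset Strict Implicit.
Unset Printing Implicit Defensive.

Import GRing.Theory.
Local Open Scope ring_scope.

(* S is an iterated Ore extension k[x][y; x -> -x][t; x <-> y], hence a domain
   with a degree in t, whose coefficients have a degree in y and, after the
   swap, in x. If w <> 0 is normal, cancelling these degrees in w x = p w,
   w y = q w, w t = r w shows that p, q, r are a x, a y, c t up to the swap,
   which occurs exactly when the t-degree of w is odd. Comparing coefficients,
   w lies in S t, or in x S y, or commutes with x and y.
   An automorphism f preserves normality. For w = f t, irreducibility of t
   excludes x S y and reduces S t to f t = b t; if f t commuted with x and y,
   then f y would be f x with its coefficients rescaled, contradicting
   f x f y = - f y f x at the leading coefficients. For w = f (x y), a factor t
   is impossible, so f x f y = x z y; reading this for the inverse of f gives
   x y = f x f z f y, so the degrees force f x and f y to be proportional to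
   x and y, in some order. *)

(** * Ore extensions *)

Section Iterate.
Variables (k : fieldType) (A : algType k) (s : {lrmorphism A -> A}).

Lemma iter_rmorph0 n : iter n s 0 = 0.
Proof. by elim: n => //= n ->; rewrite rmorph0. Qed.
Lemma iter_rmorph1 n : iter n s 1 = 1.
Proof. by elim: n => //= n ->; rewrite rmorph1. Qed.
Lemma iter_rmorphD n : {morph iter n s : a b / a + b}.
Proof. by move=> a b; elim: n => //= n ->; rewrite rmorphD. Qed.
Lemma iter_rmorphN n : {morph iter n s : a / - a}.
Proof. by move=> a; elim: n => //= n ->; rewrite rmorphN. Qed.
Lemma iter_rmorphM n : {morph iter n s : a b / a * b}.
Proof. by move=> a b; elim: n => //= n ->; rewrite rmorphM. Qed.
Lemma iter_linearZ n c a : iter n s (c *: a) = c *: iter n s a.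
Proof. by elim: n => //= n ->; rewrite linearZ. Qed.

Hypothesis s_inj : injective s.
Lemma iter_rmorph_eq0 n a : (iter n s a == 0) = (a == 0).
Proof.
elim: n => //= n <-; apply/eqP/eqP => [|->]; last exact: rmorph0.
by move=> sa; apply: s_inj; rewrite rmorph0.
Qed.
End Iterate.

(* The Ore extension A[t; s]: a polynomial lists its coefficients, written to
   the left of the powers of t. *)
Definition ore (k : fieldType) (A : algType k) of {lrmorphism A -> A} :=
  {poly A}.

Section Ore.
Variables (k : fieldType) (A : algType k) (s : {lrmorphism A -> A}).
Local Notation ore := (ore s).

HB.instance Definition _ := GRing.Zmodule.on ore.

Definition ocoef (p : ore) (n : nat) : A := (p : {poly A})`_n.
Definition omono (a : A) (n : nat) : ore := a *: 'X^n.
(** Zero gets degree 0 here, so additivity of degrees is only claimed for nonzero factors. *)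
Definition odeg (p : ore) : nat := (size (p : {poly A})).-1.
Definition olead (p : ore) : A := ocoef p (odeg p).

Lemma ore_ext (p q : ore) : (forall n, ocoef p n = ocoef q n) -> p = q.
Proof. exact: (@polyP A p q).1. Qed.
Lemma ocoef0 n : ocoef 0 n = 0. Proof. exact: coef0. Qed.
Lemma ocoefD p q n : ocoef (p + q) n = ocoef p n + ocoef q n.
Proof. exact: coefD. Qed.
Lemma ocoefN p n : ocoef (- p) n = - ocoef p n.
Proof. exact: coefN. Qed.
Lemma ocoef_mono a i n : ocoef (omono a i) n = if n == i then a else 0.
Proof.
by rewrite /ocoef coefZ coefXn; case: eqP => _; rewrite ?mulr1 ?mulr0.
Qed.

Lemma ocoef_gt p n : (odeg p < n)%N -> ocoef p n = 0.
Proof.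
by move=> h; rewrite /ocoef nth_default // (leq_trans (leqSpred _)).
Qed.

Lemma olead_eq0 p : (olead p == 0) = (p == 0).
Proof. by rewrite -lead_coef_eq0. Qed.

Lemma odeg_ge p n : ocoef p n != 0 -> (n <= odeg p)%N.
Proof. by rewrite leqNgt; apply: contraNN => /ocoef_gt ->. Qed.

Lemma odeg_eq p n :
  ocoef p n != 0 -> (forall m, (n < m)%N -> ocoef p m = 0) -> odeg p = n.
Proof.
move=> pn pm; apply/eqP; rewrite eqn_leq odeg_ge // andbT leqNgt.
apply/negP => /pm /eqP; rewrite -[_ == 0]/(olead p == 0) olead_eq0 => /eqP p0.
by rewrite p0 ocoef0 eqxx in pn.
Qed.

Lemma ore_ind (P : ore -> Prop) :
  (forall p q, P p -> P q -> P (p + q)) -> (forall a n, P (omono a n)) ->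
  forall p, P p.
Proof.
move=> PD Pm p; have -> : p = \sum_(i < size (p : {poly A})) omono (ocoef p i) i.
  by rewrite -[LHS](coefK (p : {poly A})) poly_def.
apply: (big_ind P) => [|//|i _]; last exact: Pm.
by have := Pm 0 0%N; rewrite /omono scale0r.
Qed.

(** Moving [t ^ i] past a coefficient of [q] applies [s] to it [i] times. The truncation only makes
    the product a polynomial: no nonzero coefficient lies beyond it. *)
Definition ore_mul (p q : ore) : ore :=
  \poly_(n < size (p : {poly A}) + size (q : {poly A}))
    \sum_(i < n.+1) ocoef p i * iter i s (ocoef q (n - i)).

Lemma ocoef_mul p q n :
  ocoef (ore_mul p q) n =
  \sum_(i < n.+1) ocoef p i * iter i s (ocoef q (n - i)).
Proof.
rewrite {1}/ocoef coef_poly; case: ltnP => // n_ge.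
(* Beyond the truncation, each term has [i] at least the size of [p] or [n - i] at least the size of
   [q]. *)
rewrite big1 // => i _; have [pi|pi] := leqP (size (p : {poly A})) i.
  by rewrite {1}/ocoef nth_default // mul0r.
rewrite {2}/ocoef nth_default ?iter_rmorph0 ?mulr0 //.
by apply: leq_trans (leq_sub n_ge (ltnW pi)); rewrite addKn.
Qed.

Lemma ore_mulDl : left_distributive ore_mul +%R.
Proof.
move=> p q r; apply: ore_ext => n; rewrite ocoefD !ocoef_mul -big_split.
by apply: eq_bigr => i _; rewrite ocoefD mulrDl.
Qed.

Lemma ore_mulDr : right_distributive ore_mul +%R.
Proof.
move=> p q r; apply: ore_ext => n; rewrite ocoefD !ocoef_mul -big_split.
by apply: eq_bigr => i _; rewrite ocoefD iter_rmorphD mulrDr.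
Qed.

Lemma omono_mul a i b j :
  ore_mul (omono a i) (omono b j) = omono (a * iter i s b) (i + j).
Proof.
apply: ore_ext => n; rewrite ocoef_mul ocoef_mono.
have [ni|ni] := ltnP n i.
  rewrite big1 => [|l _]; last first.
    by rewrite ocoef_mono ltn_eqF ?mul0r // (leq_trans (ltn_ord l)).
  by rewrite ltn_eqF // (leq_trans ni) ?leq_addr.
have il : (i < n.+1)%N by [].
rewrite (bigD1 (Ordinal il)) //= big1 => [|l li]; last first.
  rewrite ocoef_mono ifN ?mul0r //.
rewrite addr0 !ocoef_mono eqxx -(eqn_add2l i) subnKC //.
by case: ifP => // _; rewrite iter_rmorph0 mulr0.
Qed.

(** Both sides are additive in each argument, so monomials suffice; there the claim is additivity of
    exponents of [s] and of [t]. *)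
Lemma ore_mulA : associative ore_mul.
Proof.
move=> p q r; elim/ore_ind: p => [p p' IH IH'|a i].
  by rewrite !ore_mulDl IH IH'.
elim/ore_ind: q => [q q' IH IH'|b j].
  by rewrite ore_mulDl !ore_mulDr ore_mulDl IH IH'.
elim/ore_ind: r => [r r' IH IH'|c l].
  by rewrite !ore_mulDr IH IH'.
by rewrite !omono_mul iter_rmorphM -iterD addnA mulrA.
Qed.

Lemma ore_mul1 : left_id (omono 1 0) ore_mul.
Proof.
move=> p; elim/ore_ind: p => [p q IH IH'|a i].
  by rewrite ore_mulDr IH IH'.
by rewrite omono_mul mul1r.
Qed.

Lemma ore_1mul : right_id (omono 1 0) ore_mul.
Proof.
move=> p; elim/ore_ind: p => [p q IH IH'|a i].
  by rewrite ore_mulDl IH IH'.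
by rewrite omono_mul iter_rmorph1 mulr1 addn0.
Qed.

Lemma omono_eq0 a n : (omono a n == 0) = (a == 0).
Proof.
apply/eqP/eqP => [/(congr1 (ocoef^~ n))|->]; last exact: scale0r.
by rewrite ocoef_mono eqxx ocoef0.
Qed.

Fact ore_1_neq0 : omono 1 0 != 0.
Proof. by rewrite omono_eq0 oner_eq0. Qed.

HB.instance Definition _ := GRing.Zmodule_isNzRing.Build ore
  ore_mulA ore_mul1 ore_1mul ore_mulDl ore_mulDr ore_1_neq0.

(** Polynomials over [A] carry scalars from [A]; the field acts through its image in [A], which [s]
    fixes. *)
Definition ore_scale (c : k) (p : ore) : ore := (c%:A : A) *: (p : {poly A}).

Lemma ocoef_scale c p n : ocoef (ore_scale c p) n = c *: ocoef p n.
Proof. by rewrite /ocoef coefZ mulr_algl. Qed.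

Fact ore_scaleA a b p : ore_scale a (ore_scale b p) = ore_scale (a * b) p.
Proof. by apply: ore_ext => n; rewrite !ocoef_scale scalerA. Qed.
Fact ore_scale1 : left_id 1 ore_scale.
Proof. by move=> p; apply: ore_ext => n; rewrite !ocoef_scale scale1r. Qed.
Fact ore_scaleDr : right_distributive ore_scale +%R.
Proof.
by move=> c p q; apply: ore_ext => n; rewrite !(ocoef_scale, ocoefD) scalerDr.
Qed.
Fact ore_scaleDl p : {morph ore_scale^~ p : a b / a + b}.
Proof.
by move=> a b; apply: ore_ext => n; rewrite !(ocoef_scale, ocoefD) scalerDl.
Qed.
HB.instance Definition _ := GRing.Zmodule_isLmodule.Build k ore
  ore_scaleA ore_scale1 ore_scaleDr ore_scaleDl.

Lemma ocoefZ (c : k) (p : ore) n : ocoef (c *: p) n = c *: ocoef p n.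
Proof. exact: ocoef_scale. Qed.

Lemma ocoefM (p q : ore) n :
  ocoef (p * q) n = \sum_(i < n.+1) ocoef p i * iter i s (ocoef q (n - i)).
Proof. exact: ocoef_mul. Qed.

Fact ore_scaleAl (c : k) (p q : ore) : c *: (p * q) = (c *: p) * q.
Proof.
apply: ore_ext => n; rewrite ocoefZ !ocoefM scaler_sumr.
by apply: eq_bigr => i _; rewrite ocoefZ scalerAl.
Qed.
HB.instance Definition _ := GRing.Lmodule_isLalgebra.Build k ore ore_scaleAl.

Fact ore_scaleAr (c : k) (p q : ore) : c *: (p * q) = p * (c *: q).
Proof.
apply: ore_ext => n; rewrite ocoefZ !ocoefM scaler_sumr.
by apply: eq_bigr => i _; rewrite ocoefZ iter_linearZ scalerAr.
Qed.
HB.instance Definition _ := GRing.Lalgebra_isAlgebra.Build k ore ore_scaleAr.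

(** * Constants, the variable, and multiplication by them *)

Definition oconst (a : A) : ore := omono a 0.
Definition ovar : ore := omono 1 1.

Lemma omonoM a i b j : omono a i * omono b j = omono (a * iter i s b) (i + j).
Proof. exact: omono_mul. Qed.

Fact oconst_linear : linear oconst.
Proof.
move=> c a b; apply: ore_ext => n; rewrite ocoefD ocoefZ !ocoef_mono.
by case: ifP => // _; rewrite scaler0 addr0.
Qed.
Fact oconst_monoid : monoid_morphism oconst.
Proof. by split=> // a b; rewrite omonoM. Qed.
HB.instance Definition _ := GRing.isLinear.Build k A ore _ oconst oconst_linear.
HB.instance Definition _ :=
  GRing.isMonoidMorphism.Build A ore oconst oconst_monoid.

Lemma omonoE a n : omono a n = oconst a * ovar ^+ n.
Proof.
elim: n => [|n IHn]; first by rewrite mulr1.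
by rewrite exprSr mulrA -IHn omonoM iter_rmorph1 mulr1 addn1.
Qed.

Lemma ovar_const a : ovar * oconst a = oconst (s a) * ovar.
Proof. by rewrite !omonoM mul1r mulr1. Qed.

Lemma ocoef_const a n : ocoef (oconst a) n = if n == 0 then a else 0.
Proof. exact: ocoef_mono. Qed.

Lemma oconst_inj : injective oconst.
Proof. by move=> a b /(congr1 (ocoef^~ 0)); rewrite !ocoef_const. Qed.

Lemma ocoef_constl a p n : ocoef (oconst a * p) n = a * ocoef p n.
Proof.
rewrite ocoefM big_ord_recl big1 => [|i _]; last by rewrite ocoef_const mul0r.
by rewrite ocoef_const addr0 subn0.
Qed.

Lemma ocoef_constr p a n : ocoef (p * oconst a) n = ocoef p n * iter n s a.
Proof.
rewrite ocoefM big_ord_recr big1 => [|i _] /=; last first.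
  by rewrite ocoef_const subn_eq0 leqNgt ltn_ord iter_rmorph0 mulr0.
by rewrite subnn ocoef_const add0r.
Qed.

Lemma ocoef_varr p n : ocoef (p * ovar) n = if n is m.+1 then ocoef p m else 0.
Proof.
elim/ore_ind: p n => [p q IH IH'|a i] n.
  by rewrite mulrDl ocoefD IH IH'; case: n => [|n]; rewrite ?addr0 ?ocoefD.
rewrite omonoM iter_rmorph1 mulr1 addn1 ocoef_mono.
by case: n => // n; rewrite eqSS ocoef_mono.
Qed.

Lemma ocoef_varl p n :
  ocoef (ovar * p) n = if n is m.+1 then s (ocoef p m) else 0.
Proof.
elim/ore_ind: p n => [p q IH IH'|a i] n.
  by rewrite mulrDr ocoefD IH IH'; case: n => [|n]; rewrite ?addr0 ?ocoefD ?rmorphD.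
rewrite omonoM mul1r add1n ocoef_mono.
by case: n => // n; rewrite eqSS ocoef_mono; case: eqP; rewrite ?rmorph0.
Qed.

(** Multiplication by [t] on the right shifts coefficients without twisting them, so shifting back
    gives the quotient. *)
Lemma ovar_factor p : ocoef p 0 = 0 -> exists q, p = q * ovar.
Proof.
move=> p0; exists (\poly_(i < size (p : {poly A})) ocoef p i.+1).
apply: ore_ext => -[|n]; rewrite ocoef_varr // [RHS]coef_poly.
case: ltnP => // pn; rewrite /ocoef nth_default //; exact: leqW.
Qed.

(** * Degrees and leading coefficients over a domain *)

Section Domain.
Hypothesis s_inj : injective s.
Hypothesis A_dom : forall a b : A, a * b = 0 -> a = 0 \/ b = 0.

Lemma ocoefM_top (p q : ore) :
  ocoef (p * q) (odeg p + odeg q) = olead p * iter (odeg p) s (olead q).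
Proof.
have lt_p : (odeg p < (odeg p + odeg q).+1)%N by rewrite ltnS leq_addr.
rewrite ocoefM (bigD1 (Ordinal lt_p)) //= addKn big1 ?addr0 // => i.
rewrite -val_eqE /= neq_ltn => /orP[ip|pi].
  rewrite [X in iter _ _ X]ocoef_gt ?iter_rmorph0 ?mulr0 //.
  by rewrite -(ltn_add2l i) subnKC ?ltn_add2r // -ltnS.
by rewrite ocoef_gt ?mul0r.
Qed.

Lemma ocoefM_gt (p q : ore) n :
  (odeg p + odeg q < n)%N -> ocoef (p * q) n = 0.
Proof.
move=> pqn; rewrite ocoefM big1 // => i _.
have [pi|ip] := ltnP (odeg p) i; first by rewrite ocoef_gt ?mul0r.
rewrite [X in iter _ _ X]ocoef_gt ?iter_rmorph0 ?mulr0 //.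
rewrite -(ltn_add2l i) subnKC; last by rewrite -ltnS.
by apply: leq_ltn_trans pqn; rewrite leq_add2r.
Qed.

Lemma olead_mul_neq0 (p q : ore) : p != 0 -> q != 0 ->
  olead p * iter (odeg p) s (olead q) != 0.
Proof.
rewrite -!olead_eq0 -(iter_rmorph_eq0 s_inj (odeg p) (olead q)) => p0 q0.
by apply/eqP => /A_dom[] /eqP; apply/negP.
Qed.

Lemma odegM (p q : ore) : p != 0 -> q != 0 -> odeg (p * q) = (odeg p + odeg q)%N.
Proof.
move=> p0 q0; apply: odeg_eq; last exact: ocoefM_gt.
by rewrite ocoefM_top olead_mul_neq0.
Qed.

Lemma oleadM (p q : ore) : p != 0 -> q != 0 ->
  olead (p * q) = olead p * iter (odeg p) s (olead q).
Proof. by move=> p0 q0; rewrite /olead odegM ?ocoefM_top. Qed.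

Lemma ore_domain (p q : ore) : p * q = 0 -> p = 0 \/ q = 0.
Proof.
move=> pq0; have [->|p0] := eqVneq p 0; first by left.
have [->|q0] := eqVneq q 0; first by right.
by have := olead_mul_neq0 p0 q0; rewrite -ocoefM_top pq0 ocoef0 eqxx.
Qed.
End Domain.

Lemma odeg_mono a n : a != 0 -> odeg (omono a n) = n.
Proof.
move=> a0; apply: odeg_eq => [|m nm]; rewrite ocoef_mono ?eqxx //.
by rewrite gtn_eqF.
Qed.

Lemma odeg_const a : odeg (oconst a) = 0.
Proof.
have [->|a0] := eqVneq a 0; last exact: odeg_mono.
by rewrite rmorph0 /odeg size_poly0.
Qed.

Lemma odeg0_const p : odeg p = 0 -> p = oconst (ocoef p 0).
Proof.
move=> p0; apply: ore_ext => -[|n]; rewrite ocoef_const //.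
by rewrite ocoef_gt ?p0.
Qed.

Lemma odegZ (c : k) (p : ore) : c != 0 -> odeg (c *: p) = odeg p.
Proof.
have [->|p0 c0] := eqVneq p 0; first by rewrite scaler0.
apply: odeg_eq => [|m pm]; rewrite ocoefZ.
  by rewrite scaler_eq0 negb_or c0 olead_eq0.
by rewrite ocoef_gt ?scaler0.
Qed.

(** The universal property of the Ore extension: the hypothesis is the image of the rule
    [t a = s(a) t]. *)
Lemma ore_lift (B : algType k) (f : {lrmorphism A -> B}) (T : B) :
  (forall a, T * f a = f (s a) * T) ->
  exists g : {lrmorphism ore -> B}, (forall a, g (oconst a) = f a) /\ g ovar = T.
Proof.
move=> fT; pose g (p : ore) : B :=
  \sum_(i < size (p : {poly A})) f (ocoef p i) * T ^+ i.
(* Padding with zero terms lets [p], [q] and [c *: p + q] be summed over one common range. *)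
have gE N (p : ore) : (size (p : {poly A}) <= N)%N ->
    g p = \sum_(i < N) f (ocoef p i) * T ^+ i.
  move=> pN; pose F i := f (ocoef p i) * T ^+ i.
  rewrite -[g p]/(\sum_(i < size (p : {poly A})) F i) (big_ord_widen N F pN).
  rewrite big_mkcond; apply: eq_bigr => i _; rewrite /F; case: ltnP => // pi.
  by rewrite /ocoef nth_default // rmorph0 mul0r.
have glin : linear g.
  move=> c p q; pose N := (size (p : {poly A}) + size (q : {poly A}))%N.
  rewrite (gE N p) ?leq_addr // (gE N q) ?leq_addl // (gE N) //; last first.
    apply/leq_sizeP => j Nj.
    rewrite -[LHS]/(ocoef (c *: p + q) j) ocoefD ocoefZ /ocoef.
    rewrite !nth_default ?scaler0 ?addr0 //.
      by rewrite (leq_trans _ Nj) ?leq_addl.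
    by rewrite (leq_trans _ Nj) ?leq_addr.
  rewrite scaler_sumr -big_split; apply: eq_bigr => i _ /=.
  by rewrite ocoefD ocoefZ linearP mulrDl scalerAl.
have gD : {morph g : p q / p + q}.
  by move=> p q; rewrite -[p]scale1r glin !scale1r.
have gm a n : g (omono a n) = f a * T ^+ n.
  rewrite (gE n.+1); last first.
    by rewrite (leq_trans (size_scale_leq _ _)) ?size_polyXn.
  rewrite big_ord_recr big1 => [|i _] /=; rewrite ocoef_mono.
    by rewrite eqxx add0r.
  by rewrite ltn_eqF // rmorph0 mul0r.
have Tn n a : T ^+ n * f a = f (iter n s a) * T ^+ n.
  elim: n => [|n IHn]; first by rewrite mul1r mulr1.
  by rewrite exprS -mulrA IHn mulrA fT -mulrA.
have gM : monoid_morphism g.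
  split=> [|p q]; first by rewrite gm rmorph1 mul1r.
  elim/ore_ind: p => [p p' IH IH'|a i]; first by rewrite mulrDl !gD IH IH' mulrDl.
  elim/ore_ind: q => [q q' IH IH'|b j]; first by rewrite mulrDr !gD IH IH' mulrDr.
  by rewrite omonoM !gm rmorphM exprD /= -!mulrA; congr (_ * _); rewrite !mulrA Tn.
pose L := GRing.isLinear.Build k ore B _ g glin.
pose M := GRing.isMonoidMorphism.Build ore B g gM.
exists (HB.pack g L M : {lrmorphism ore -> B}).
split=> [a|]; rewrite [LHS]gm ?mulr1 //.
by rewrite rmorph1 mul1r.
Qed.

Lemma ore_mext (B : algType k) (f g : {lrmorphism ore -> B}) :
  (forall a, f (oconst a) = g (oconst a)) -> f ovar = g ovar -> f =1 g.
Proof.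
move=> fg fgt; elim/ore_ind => [p q fp fq|a n]; first by rewrite !rmorphD /= fp fq.
by rewrite omonoE !rmorphM !rmorphXn /= fg fgt.
Qed.

End Ore.

(** * The skew plane *)

Fact horner_alg_linear (k : fieldType) (B : algType k) (b : B) :
  linear (horner_alg b : {poly k} -> B).
Proof.
by move=> c p q; rewrite rmorphD -mul_polyC rmorphM /= horner_algC mulr_algl.
Qed.
Fact poly_lift_exists (k : fieldType) (B : algType k) (b : B) :
  exists f : {lrmorphism {poly k} -> B}, f 'X = b.
Proof.
pose L := GRing.isLinear.Build k {poly k} B _ _ (horner_alg_linear b).
pose M := GRing.RMorphism.on (horner_alg b).
pose f : {lrmorphism {poly k} -> B} := HB.pack (horner_alg b : {poly k} -> B) M L.
exists f; exact: horner_algX.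
Qed.

Definition poly_lift (k : fieldType) (B : algType k) (b : B) :=
  projT1 (cid (poly_lift_exists b)).

Lemma poly_liftX (k : fieldType) (B : algType k) (b : B) : poly_lift b 'X = b.
Proof. by rewrite /poly_lift; case: cid. Qed.

(* All that the determination of Aut(S) uses about k_{-1}[x, y]. [pdeg] is the
   degree in y, so that [pdeg \o pswap] is the degree in x. *)
Record skew_plane (k : fieldType) := SkewPlane {
  plane : algType k;
  px : plane;
  py : plane;
  pswap : {lrmorphism plane -> plane};
  pdeg : plane -> nat;
  p_anti : px * py = - (py * px);
  p_lift : forall (B : algType k) (u v : B), u * v = - (v * u) ->
    exists g : {lrmorphism plane -> B}, g px = u /\ g py = v;
  p_mext : forall (B : algType k) (f g : {lrmorphism plane -> B}),
    f px = g px -> f py = g py -> f =1 g;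
  p_ind : forall P : plane -> Prop, (forall c : k, P c%:A) -> P px -> P py ->
    (forall a b, P a -> P b -> P (a + b)) ->
    (forall a b, P a -> P b -> P (a * b)) -> forall a, P a;
  pswap_x : pswap px = py;
  pswap_y : pswap py = px;
  p_domain : forall u v : plane, u * v = 0 -> u = 0 \/ v = 0;
  pdegM : forall u v : plane, u != 0 -> v != 0 ->
    pdeg (u * v) = (pdeg u + pdeg v)%N;
  pdegZ : forall (c : k) (u : plane), c != 0 -> pdeg (c *: u) = pdeg u;
  px_neq0 : px != 0;
  py_neq0 : py != 0;
  pdeg_x : pdeg px = 0;
  pdeg_y : pdeg py = 1;
  p_scalar : forall u : plane,
    pdeg u = 0 -> pdeg (pswap u) = 0 -> exists c : k, u = c%:A;
  p_affine : forall u : plane, pdeg u = 0 -> pdeg (pswap u) = 1 ->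
    exists2 a : k, a != 0 & exists c : k, u = a *: px + c%:A;
  p_affine_anti : forall a b c d : k, a != 0 -> b != 0 ->
    (a *: px + c%:A) * (b *: py + d%:A) =
      - ((b *: py + d%:A) * (a *: px + c%:A)) -> c = 0 /\ d = 0;
  p_twisted : forall (u : plane) (a : k), a != 1 ->
    u * px = a *: (px * u) -> u * py = a *: (py * u) ->
    exists v : plane, u = px * v * py
}.

Section SkewPlane.
Variable k : fieldType.

Definition negX : {lrmorphism {poly k} -> {poly k}} := poly_lift (- 'X).

Lemma poly_mext (B : algType k) (f g : {lrmorphism {poly k} -> B}) :
  f 'X = g 'X -> f =1 g.
Proof.
move=> fg; elim/poly_ind => [|p c IH]; first by rewrite !rmorph0.
by rewrite !rmorphD !rmorphM /= IH fg -alg_polyC !rmorph_alg.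
Qed.

Lemma negXX : negX 'X = - 'X.
Proof. exact: poly_liftX. Qed.

Lemma negXK : involutive negX.
Proof.
apply: (poly_mext (f := negX \o negX) (g := idfun)).
by rewrite /= negXX rmorphN /= negXX opprK.
Qed.

(** This is [k_{-1}[x, y]], with polynomials in [x] written to the left of powers of [y]. *)
Definition skewV : algType k := ore negX.
Definition vdeg (u : skewV) : nat := odeg (u : ore negX).
Definition vx : skewV := oconst negX 'X.
Definition vy : skewV := ovar negX.

Lemma v_anti : vx * vy = - (vy * vx).
Proof. by rewrite ovar_const negXX rmorphN mulNr opprK. Qed.

(** Passing [v] across each factor [u] costs a sign, which is what [negX] records. This is the
    commutation rule that [ore_lift] asks for. *)
Lemma poly_lift_anti (B : algType k) (u v : B) (P : {poly k}) :
  u * v = - (v * u) -> v * poly_lift u P = poly_lift u (negX P) * v.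
Proof.
move=> uv; elim/poly_ind: P => [|P c IH]; first by rewrite !rmorph0 mulr0 mul0r.
rewrite !rmorphD !rmorphM /= negXX rmorphN /= -!alg_polyC !rmorph_alg poly_liftX.
rewrite mulrDr mulrA IH mulrDl mulrN mulNr -!mulrA uv mulrN opprK.
by rewrite mulr_algl mulr_algr.
Qed.

Lemma skewV_lift (B : algType k) (u v : B) : u * v = - (v * u) ->
  exists g : {lrmorphism skewV -> B}, g vx = u /\ g vy = v.
Proof.
move=> uv; have [|g [gc gt]] := ore_lift (s := negX) (f := poly_lift u) (T := v).
  by move=> P; exact: poly_lift_anti.
by exists g; split; rewrite ?gc ?poly_liftX.
Qed.

Lemma skewV_mext (B : algType k) (f g : {lrmorphism skewV -> B}) :
  f vx = g vx -> f vy = g vy -> f =1 g.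
Proof.
move=> fx fy; apply: ore_mext => // P.
exact: (poly_mext (f := f \o oconst negX) (g := g \o oconst negX)).
Qed.

Fact swap_exists : exists g : {lrmorphism skewV -> skewV}, g vx = vy /\ g vy = vx.
Proof. by apply: skewV_lift; rewrite v_anti opprK. Qed.
Definition swapV := projT1 (cid swap_exists).

Lemma swap_x : swapV vx = vy. Proof. by rewrite /swapV; case: cid => g []. Qed.
Lemma swap_y : swapV vy = vx. Proof. by rewrite /swapV; case: cid => g []. Qed.

Lemma skewV_domain (u v : skewV) : u * v = 0 -> u = 0 \/ v = 0.
Proof.
apply: ore_domain => [|a b /eqP]; first exact: inv_inj negXK.
by rewrite mulf_eq0 => /orP[] /eqP; [left | right].
Qed.

Lemma vdegM (u v : skewV) : u != 0 -> v != 0 ->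
  vdeg (u * v) = (vdeg u + vdeg v)%N.
Proof.
apply: odegM => [|a b /eqP]; first exact: inv_inj negXK.
by rewrite mulf_eq0 => /orP[] /eqP; [left | right].
Qed.

Lemma vdegZ (c : k) (u : skewV) : c != 0 -> vdeg (c *: u) = vdeg u.
Proof. exact: odegZ. Qed.

Lemma vx_neq0 : vx != 0.
Proof. by rewrite /vx /oconst omono_eq0 polyX_eq0. Qed.
Lemma vy_neq0 : vy != 0.
Proof. by rewrite /vy /ovar omono_eq0 oner_eq0. Qed.
Lemma vdeg_vx : vdeg vx = 0. Proof. exact: odeg_const. Qed.
Lemma vdeg_vy : vdeg vy = 1. Proof. by apply: odeg_mono; exact: oner_neq0. Qed.

Lemma ocoef_lift_vy (P : {poly k}) n :
  ocoef (poly_lift vy P : skewV) n = (P`_n)%:P.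
Proof.
elim/poly_ind: P n => [|P c IH] n; first by rewrite rmorph0 ocoef0 coef0.
rewrite rmorphD rmorphM /= poly_liftX ocoefD ocoef_varr coefD coefMX coefC.
rewrite -alg_polyC rmorph_alg ocoefZ ocoef_mono.
case: n => [|n] /=; last by rewrite IH scaler0 !addr0.
by rewrite !add0r alg_polyC.
Qed.

(** The swap turns a polynomial in [x] into the same polynomial in [y], so the degree in [x] becomes
    readable as a degree in [y]. *)
Lemma vdeg_swap_const (P : {poly k}) :
  vdeg (swapV (oconst negX P)) = (size P).-1.
Proof.
have -> : swapV (oconst negX P) = poly_lift vy P.
  apply: (poly_mext (f := swapV \o oconst negX) (g := poly_lift vy)).
  by rewrite /= -/vx swap_x poly_liftX.
have <- : map_poly polyC P = poly_lift vy P :> {poly {poly k}}.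
  apply/polyP => n; rewrite coef_map /=; exact/esym/ocoef_lift_vy.
by rewrite /vdeg /odeg size_map_polyC.
Qed.

Lemma scalar_of_degrees (u : skewV) :
  vdeg u = 0 -> vdeg (swapV u) = 0 -> exists c : k, u = c%:A.
Proof.
move=> /odeg0_const ->; set P := ocoef u 0; rewrite vdeg_swap_const => P1.
exists P`_0; rewrite {1}[P]size1_polyC; last by case: (size P) P1 => [|[]].
by rewrite -alg_polyC rmorph_alg.
Qed.

Lemma affine_of_degrees (u : skewV) : vdeg u = 0 -> vdeg (swapV u) = 1 ->
  exists2 a : k, a != 0 & exists c : k, u = a *: vx + c%:A.
Proof.
move=> /odeg0_const ->; set P := ocoef u 0; rewrite vdeg_swap_const => P2.
have szP : size P = 2 by case: (size P) P2 => [|[|[]]].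
exists P`_1; last exists P`_0.
  by have := lead_coef_eq0 P; rewrite lead_coefE szP /= -size_poly_eq0 szP => ->.
rewrite -linearZ -[_%:A](rmorph_alg (oconst negX)) -rmorphD; congr oconst.
apply/polyP => n; rewrite coefD coefZ coefX alg_polyC coefC.
case: n => [|[|n]] /=; rewrite ?mulr0 ?mulr1 ?add0r ?addr0 //.
by rewrite nth_default ?szP.
Qed.

Hypothesis char2 : 2%:R != 0 :> k.

Lemma opp_eq0 (V : lmodType k) (u : V) : u = - u -> u = 0.
Proof.
move=> /eqP; rewrite -subr_eq0 opprK -mulr2n -scaler_nat scaler_eq0.
by rewrite (negPf char2) => /eqP.
Qed.

(** The [xy] terms cancel, and what remains is twice an affine expression. Its coefficients in [y]
    give first [c * b = 0], then [a * d = 0]. *)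
Lemma affine_anti (a b c d : k) : a != 0 -> b != 0 ->
  (a *: vx + c%:A) * (b *: vy + d%:A) = - ((b *: vy + d%:A) * (a *: vx + c%:A)) ->
  c = 0 /\ d = 0.
Proof.
move=> a0 b0 anti.
have E : (a * d) *: vx + (c * b) *: vy + (c * d)%:A = 0.
  apply: opp_eq0; move: anti; rewrite !mulrDl !mulrDr -!scalerAl -!scalerAr.
  rewrite !mul1r !mulr1 !scalerA v_anti scalerN !opprD.
  rewrite [b * a]mulrC [d * a]mulrC [b * c]mulrC [d * c]mulrC => E.
  move: E; rewrite -!addrA => /addrI; rewrite !addrA => ->.
  by rewrite [- _ - _ in LHS]addrC.
have := congr1 (fun u => ocoef u 1) E; have := congr1 (fun u => ocoef u 0) E.
rewrite !ocoefD !ocoefZ !ocoef_mono /= !ocoef0 !scaler0 !addr0 add0r.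
move=> E0 /eqP; rewrite scaler_eq0 oner_eq0 orbF mulf_eq0 (negPf b0) orbF => /eqP c0.
split=> //; move/eqP: E0; rewrite c0 mul0r scale0r addr0.
by rewrite scaler_eq0 polyX_eq0 orbF mulf_eq0 (negPf a0) => /eqP.
Qed.

Lemma skewV_ind (P : skewV -> Prop) :
  (forall c : k, P c%:A) -> P vx -> P vy ->
  (forall a b, P a -> P b -> P (a + b)) ->
  (forall a b, P a -> P b -> P (a * b)) -> forall a, P a.
Proof.
move=> Pc Px Py PD PM; apply: ore_ind => [a b|a n]; first exact: (PD).
rewrite omonoE; apply: (PM); last first.
  elim: n => [|n IHn]; first by have := Pc 1; rewrite scale1r.
  by rewrite exprS; apply: (PM).
elim/poly_ind: a => [|a c IH]; first by have := Pc 0; rewrite scale0r rmorph0.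
rewrite !rmorphD !rmorphM /=; apply: (PD); first exact: (PM).
by rewrite -alg_polyC !rmorph_alg; exact: Pc.
Qed.

Lemma negX_at0 (P : {poly k}) : (negX P).[0] = P.[0].
Proof.
elim/poly_ind: P => [|P c _]; first by rewrite rmorph0.
rewrite rmorphD rmorphM /= negXX -alg_polyC rmorph_alg !hornerE.
by rewrite oppr0 mulr0 add0r.
Qed.

(** In degree 0 in [y] coefficients commute with [x], so [(1 - a) x u_0 = 0] and [y] divides [u] on
    the right. Commutation with [y] twists coefficients by [x -> -x], which is invisible at [x = 0];
    hence every coefficient vanishes there and is divisible by [x]. *)
Lemma twisted_factor (u : skewV) (a : k) : a != 1 ->
  u * vx = a *: (vx * u) -> u * vy = a *: (vy * u) ->
  exists v : skewV, u = vx * v * vy.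
Proof.
move=> a1 ux uy; have u0 : ocoef (u : ore negX) 0 = 0.
  have := congr1 (fun u : ore negX => ocoef u 0) ux.
  rewrite ocoefZ ocoef_constl ocoef_constr /= mulrC => /eqP.
  rewrite -subr_eq0 -{1}[_ * _]scale1r -scalerBl scaler_eq0 subr_eq0 eq_sym (negPf a1).
  by rewrite mulf_eq0 polyX_eq0 => /eqP.
have [w uw] := ovar_factor u0.
have w0 j : (ocoef w j).[0] = 0.
  have := congr1 (fun u : ore negX => ocoef u j.+2) uy.
  rewrite ocoefZ ocoef_varr ocoef_varl uw !ocoef_varr => /(congr1 (horner^~ 0)).
  rewrite hornerZ negX_at0 => /eqP; rewrite -subr_eq0 -{1}[_.[0]]mul1r -mulrBl.
  by rewrite mulf_eq0 subr_eq0 eq_sym (negPf a1) => /eqP.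
pose v : ore negX := \poly_(j < size (w : {poly {poly k}})) (ocoef w j %/ 'X).
exists v; rewrite uw; congr (_ * _); apply: ore_ext => j.
rewrite ocoef_constl {2}/ocoef coef_poly mulrC.
case: ltnP => [_|wj]; last by rewrite mul0r /ocoef nth_default.
by rewrite divpK // -['X]subr0 dvdp_XsubCl rootE w0.
Qed.

Definition skew_plane_model : skew_plane k :=
  SkewPlane v_anti skewV_lift skewV_mext skewV_ind swap_x swap_y
    skewV_domain vdegM vdegZ vx_neq0 vy_neq0 vdeg_vx vdeg_vy
    scalar_of_degrees affine_of_degrees affine_anti twisted_factor.
End SkewPlane.

(** * Normal elements and automorphisms of the Ore extension of a skew plane *)

Section AutomorphismMorphism.
Variables (k : fieldType) (A : algType k) (f : alg_aut A).

Fact aut_linear : linear f. Proof. by case: (alg_autP f). Qed.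
Fact aut_monoid : monoid_morphism f. Proof. by case: (alg_autP f). Qed.
HB.instance Definition _ := GRing.isLinear.Build k A A _ (aut_fun f) aut_linear.
HB.instance Definition _ :=
  GRing.isMonoidMorphism.Build A A (aut_fun f) aut_monoid.
End AutomorphismMorphism.

Section OreModel.
Variables (k : fieldType) (pl : skew_plane k).
Local Notation A := (plane pl).
Local Notation s := (pswap pl).
Local Notation xA := (px pl).
Local Notation yA := (py pl).
Local Notation D := (ore s).
Local Notation degA := (@pdeg _ pl).

Lemma pswapK : involutive s.
Proof.
by apply: (p_mext (f := s \o s) (g := idfun));
   rewrite /= ?(pswap_x, pswap_y).
Qed.

Lemma iter_pswapK n : involutive (iter n s).
Proof. by elim: n => // n IHn a; rewrite iterSr /= pswapK IHn. Qed.

Lemma iter_pswap_x n : iter n s xA = if odd n then yA else xA.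
Proof. by elim: n => //= n ->; case: ifP; rewrite ?(pswap_x, pswap_y). Qed.
Lemma iter_pswap_y n : iter n s yA = if odd n then xA else yA.
Proof. by elim: n => //= n ->; case: ifP; rewrite ?(pswap_x, pswap_y). Qed.

Lemma pswap_eq0 u : (s u == 0) = (u == 0).
Proof. exact: (iter_rmorph_eq0 (inv_inj pswapK) 1). Qed.

(** For nonzero [e], the two sides of the first equation differ by one in their degree in [y]. The
    second equation is the swap of the first. *)
Lemma no_crossing (e : A) b :
  e * xA = b *: (yA * e) \/ e * yA = b *: (xA * e) -> b != 0 -> e = 0.
Proof.
have main e' : e' * xA = b *: (yA * e') -> b != 0 -> e' = 0.
  move=> ee b0; apply/eqP/negPn/negP => e0; move/(congr1 degA): ee.
  rewrite pdegZ ?pdegM ?px_neq0 ?py_neq0 // pdeg_x pdeg_y.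
  by move/eqP; rewrite addnC eqn_add2r.
case=> [|ee b0]; first exact: main.
apply/eqP; rewrite -pswap_eq0; apply/eqP/main => //.
by rewrite -[in LHS]pswap_y -[in RHS]pswap_x -!rmorphM -linearZ ee.
Qed.

Definition dx : D := oconst s xA.
Definition dy : D := oconst s yA.
Definition dt : D := ovar s.

Lemma d_xy : dx * dy = - (dy * dx).
Proof. by rewrite /dx /dy -!rmorphM -rmorphN /= p_anti. Qed.
Lemma d_tx : dt * dx = dy * dt.
Proof. by rewrite ovar_const pswap_x. Qed.
Lemma d_ty : dt * dy = dx * dt.
Proof. by rewrite ovar_const pswap_y. Qed.

Lemma oreD_mext (B : algType k) (f g : {lrmorphism D -> B}) :
  f dx = g dx -> f dy = g dy -> f dt = g dt -> f =1 g.
Proof.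
move=> fx fy; apply: ore_mext => a.
exact: (p_mext (f := f \o oconst s) (g := g \o oconst s)).
Qed.

Lemma oreD_lift (B : algType k) (u v w : B) :
  u * v = - (v * u) -> w * u = v * w -> w * v = u * w ->
  exists g : {lrmorphism D -> B}, [/\ g dx = u, g dy = v & g dt = w].
Proof.
move=> uv wu wv; have [f [fx fy]] := p_lift pl uv.
have [|g [gc gt]] := ore_lift (s := s) (f := f) (T := w).
    elim/p_ind => [c|||a b IH IH'|a b IH IH'].
  - by rewrite !rmorph_alg mulr_algl mulr_algr.
  - by rewrite pswap_x fx fy.
  - by rewrite pswap_y fx fy.
  - by rewrite !rmorphD /= mulrDr mulrDl IH IH'.
  - by rewrite !rmorphM /= mulrA IH -mulrA IH' mulrA.
by exists g; split; rewrite ?gc.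
Qed.

Lemma oreD_ind (P : D -> Prop) :
  (forall c : k, P c%:A) -> P dx -> P dy -> P dt ->
  (forall a b, P a -> P b -> P (a + b)) ->
  (forall a b, P a -> P b -> P (a * b)) -> forall a, P a.
Proof.
move=> Pc Px Py Pt PD PM.
elim/ore_ind => [a b|a n]; first exact: (PD).
rewrite omonoE; apply: (PM); last first.
  elim: n => [|n IHn]; first by have := Pc 1; rewrite scale1r.
  by rewrite exprS; apply: (PM).
elim/p_ind: a => [c|||a b Pa Pb|a b Pa Pb] //.
- by rewrite rmorph_alg; exact: Pc.
- by rewrite rmorphD; apply: (PD).
- by rewrite rmorphM; apply: (PM).
Qed.

Let swap_inj : injective s := inv_inj pswapK.

Lemma ddegM (a b : D) : a != 0 -> b != 0 ->
  odeg (a * b) = (odeg a + odeg b)%N.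
Proof. exact: odegM swap_inj (@p_domain _ pl) a b. Qed.

Lemma dleadM (a b : D) : a != 0 -> b != 0 ->
  olead (a * b) = olead a * iter (odeg a) s (olead b).
Proof. exact: oleadM swap_inj (@p_domain _ pl) a b. Qed.

Lemma oreD_domain (a b : D) : a * b = 0 -> a = 0 \/ b = 0.
Proof. exact: ore_domain swap_inj (@p_domain _ pl) a b. Qed.

Lemma oreD_mulIr (w : D) : w != 0 -> injective ( *%R^~ w).
Proof.
move=> w0 a b /eqP; rewrite -subr_eq0 -mulrBl => /eqP/oreD_domain[/eqP|w1].
  by rewrite subr_eq0 => /eqP.
by rewrite w1 eqxx in w0.
Qed.

Lemma oreD_mul_neq0 (a b : D) : a != 0 -> b != 0 -> a * b != 0.
Proof. by move=> a0 b0; apply/eqP => /oreD_domain[] /eqP; apply/negP. Qed.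

Lemma dx_neq0 : dx != 0.
Proof. by rewrite /dx /oconst omono_eq0 px_neq0. Qed.
Lemma dy_neq0 : dy != 0.
Proof. by rewrite /dy /oconst omono_eq0 py_neq0. Qed.
Lemma dt_neq0 : dt != 0.
Proof. by rewrite /dt /ovar omono_eq0 oner_neq0. Qed.
Lemma odeg_dx : odeg dx = 0. Proof. exact: odeg_const. Qed.
Lemma odeg_dy : odeg dy = 0. Proof. exact: odeg_const. Qed.
Lemma odeg_dt : odeg dt = 1. Proof. by apply: odeg_mono; exact: oner_neq0. Qed.

Lemma olead_const (u : A) : olead (oconst s u) = u.
Proof. by rewrite /olead odeg_const ocoef_const. Qed.
Lemma olead_dt : olead dt = 1.
Proof. by rewrite /olead odeg_dt ocoef_mono. Qed.

(** This is the inclusion of [w R] in [R w]. In a domain, [b] is determined by [a] when [w] is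
    nonzero, so conjugation by [w] preserves relations. *)
Definition normal (R : nzRingType) (w : R) := forall a, exists b, w * a = b * w.

(** Degrees make the conjugates [p], [q] of [x], [y] affine, up to the swap, and the conjugate [r]
    of [t] of degree 1. The relation [p q = - q p] then removes the constant terms, and [r p = q r]
    equates the two scalars and removes the constant coefficient of [r]. *)
Lemma normal_action (w : D) : w != 0 -> normal w ->
  exists a c : k, [/\ a != 0, c != 0,
    w * dx = a *: (oconst s (iter (odeg w) s xA) * w),
    w * dy = a *: (oconst s (iter (odeg w) s yA) * w)
    & w * dt = c *: (dt * w)].
Proof.
move=> w0 wN; set n := odeg w; set l := olead w.
have l0 : l != 0 by rewrite olead_eq0.
(* Leading coefficients in [w u = p w] give [l * iter n s u = p_0 * l]. Applying [iter n s], an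
   involution, leaves [u] untwisted and replaces [l] by [l']. *)
pose l' := iter n s l; have l'0 : l' != 0 by rewrite (iter_rmorph_eq0 swap_inj).
have eqn0 (a b : D) : a != 0 -> w * a = b * w -> b != 0.
  move=> a0 wab; apply/eqP => b0; move/eqP: wab.
  by rewrite b0 mul0r => /eqP/oreD_domain[] /eqP; apply/negP.
(* Conjugation by w preserves degree 0 in t, and its effect on leading
   coefficients is read off by cancelling the degrees in y and, after the swap,
   in x. *)
have deg0 u (p : D) : u != 0 -> w * oconst s u = p * w ->
    exists v : A, [/\ p = oconst s (iter n s v), l' * u = v * l',
      degA v = degA u & degA (s v) = degA (s u)].
  move=> u0 wu; have cu0 : oconst s u != 0 by rewrite /oconst omono_eq0.
  have p0 := eqn0 _ _ cu0 wu.
  have degp : odeg p = 0.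
    move/(congr1 (@odeg _ _ _)): (wu); rewrite !ddegM // odeg_const addn0.
    by move/eqP; rewrite -[X in X == _]add0n eqn_add2r => /eqP.
  have pE := odeg0_const degp.
  have lp : olead p = ocoef p 0 by rewrite /olead degp.
  have := congr1 (@olead _ _ _) wu; rewrite !dleadM // olead_const degp /= lp.
  rewrite -/l -/n => lu; set p0' := ocoef p 0 in pE lu *.
  pose v := iter n s p0'; have lv : l' * u = v * l'.
    by rewrite -[u in LHS](iter_pswapK n) -!iter_rmorphM lu.
  have v0 : v != 0.
    apply/eqP => v0; move/eqP: lv; rewrite v0 mul0r => /eqP/p_domain[] /eqP; exact/negP.
  have degE (v1 u1 l1 : A) : v1 != 0 -> u1 != 0 -> l1 != 0 ->
      l1 * u1 = v1 * l1 -> degA v1 = degA u1.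
    move=> v10 u10 l10 /(congr1 (degA)); rewrite !pdegM // [RHS]addnC.
    by move/addnI.
  exists v; split => //; first by rewrite iter_pswapK.
    exact: degE lv.
  apply: (degE _ _ (s l')); rewrite ?pswap_eq0 //.
  by rewrite -!rmorphM lv.
have [p wx] := wN dx; have [q wy] := wN dy; have [r wt] := wN dt.
have [v [pE _ v0 v1]] := deg0 _ _ (px_neq0 pl) wx.
have [v' [qE _ v'1 v'0]] := deg0 _ _ (py_neq0 pl) wy.
rewrite pswap_x pdeg_y pdeg_x in v0 v1; rewrite pswap_y pdeg_x pdeg_y in v'1 v'0.
have [a a0 [e ve]] := p_affine v0 v1.
have [b b0 [e' ve']] : exists2 b : k, b != 0 & exists c : k, v' = b *: yA + c%:A.
  have [||b b0 [c vc]] := @p_affine _ pl (s v'); rewrite ?pswapK //.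
  exists b => //; exists c; rewrite -[LHS]pswapK vc.
  by rewrite rmorphD /= rmorph_alg linearZ_LR /= pswap_x.
have cancel_w := oreD_mulIr w0.
(* Multiplied by [w] on the right, a relation among conjugates becomes [w] times the relation among
   the generators. *)
have pq : p * q = - (q * p).
  apply: cancel_w; rewrite /= mulNr -!mulrA -wx -wy !mulrA -wx -wy -!mulrA d_xy.
  by rewrite mulrN.
have rp : r * p = q * r.
  apply: cancel_w.
  rewrite /=.
  rewrite -!mulrA.
  rewrite -wx.
  rewrite -wt.
  by rewrite !mulrA -wy -wt -!mulrA d_tx.
have vv' : v * v' = - (v' * v).
  apply: (inv_inj (iter_pswapK n)).
  rewrite iter_rmorphN !iter_rmorphM; apply: (oconst_inj (s := s)).
  by rewrite rmorphN !rmorphM /= -pE -qE.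
have [c0 c0'] : e = 0 /\ e' = 0.
  by apply: (@p_affine_anti _ pl _ _ _ _ a0 b0); rewrite -ve -ve'.
rewrite c0 scale0r addr0 in ve; rewrite c0' scale0r addr0 in ve'.
have r0 := eqn0 _ _ dt_neq0 wt.
have degr : odeg r = 1.
  move/(congr1 (@odeg _ _ _)): (wt); rewrite !ddegM ?dt_neq0 // odeg_dt addnC.
  by move/addIn.
set g := olead r; have g0 : g != 0 by rewrite olead_eq0.
have lg : l = g * s l.
  have := congr1 (@olead _ _ _) wt; rewrite !dleadM ?dt_neq0 // olead_dt degr.
  by rewrite iter_rmorph1 mulr1.
have sl0 : s l != 0 by rewrite pswap_eq0.
(* Combining [l = g * s l] with its swap [s l = s g * l] leaves no room for a positive degree of [g]
   in [x] or [y], so [g] is a scalar. *)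
have odeg_l : degA l = (degA g + degA (s l))%N by rewrite {1}lg pdegM.
have sg0 : s g != 0 by rewrite pswap_eq0.
have odeg_sl : degA (s l) = (degA (s g) + degA l)%N.
  by rewrite {1}lg rmorphM /= pswapK pdegM.
have [z gE] : exists z : k, g = z%:A.
  have : (degA g + degA (s g) == 0)%N.
    by rewrite -(eqn_add2r (degA l)) -addnA -odeg_sl -odeg_l.
  by rewrite addn_eq0 => /andP[/eqP ? /eqP ?]; apply: p_scalar.
have z0 : z != 0 by apply: contra_neq g0; rewrite gE => ->; rewrite scale0r.
(* These are the coefficients of [r p = q r]: index 1 yields [a = b], and index 0 yields a crossing
   that kills the constant coefficient of [r]. *)
have rxC m : ocoef r m * iter m s (iter n s v) = iter n s v' * ocoef r m.
  by rewrite -ocoef_constr -ocoef_constl -pE -qE rp.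
have r1 : ocoef r 1 = z%:A by rewrite -gE /g /olead degr.
have swap_xn : s (iter n s xA) = iter n s yA.
  by rewrite iter_pswap_x iter_pswap_y; case: ifP; rewrite ?(pswap_x, pswap_y).
have ab : a = b.
  have := rxC 1; rewrite r1 ve ve' !iter_linearZ /= swap_xn.
  rewrite mulr_algl mulr_algr scalerA scalerA => /eqP.
  rewrite -subr_eq0 -scalerBl scaler_eq0 (iter_rmorph_eq0 swap_inj).
  rewrite (negPf (py_neq0 pl)) orbF -mulrBr mulf_eq0 (negPf z0) /=.
  by rewrite subr_eq0 => /eqP.
have re0 : ocoef r 0 = 0.
  apply/eqP; rewrite -(iter_rmorph_eq0 swap_inj n); apply/eqP.
  apply: (@no_crossing _ 1); last exact: oner_neq0.
  left; apply: (scalerI a0); rewrite scale1r.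
  have := congr1 (iter n s) (rxC 0); rewrite !iter_rmorphM !iter_pswapK ve ve' -ab.
  by rewrite -scalerAr -scalerAl.
have rE : r = z *: dt.
  apply: ore_ext => -[|[|m]]; rewrite ocoefZ ocoef_mono ?scaler0 //=.
  by rewrite ocoef_gt ?degr.
exists a, z; split=> //; rewrite ?wx ?wy ?wt ?pE ?qE ?rE ?ve ?ve' -?ab.
- by rewrite iter_linearZ linearZ_LR /= -scalerAl.
- by rewrite iter_linearZ linearZ_LR /= -scalerAl.
- by rewrite -scalerAl.
Qed.

(** By [no_crossing], nonzero coefficients of [w] occur only in degrees of the parity of its
    [t]-degree. Odd parity leaves no constant coefficient, so [t] divides [w]. For even parity,
    [a != 1] makes [p_twisted] factor each coefficient, while [a = 1] makes [w] commute with [x] and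
    [y], so that conjugation only rescales powers of [t]. *)
Lemma normal_cases (w : D) : w != 0 -> normal w ->
  [\/ exists w', w = w' * dt,
      exists z, w = dx * z * dy
    | exists2 c : k, c != 0 & forall p, exists q,
        w * p = q * w /\ forall i, ocoef q i = c ^+ i *: ocoef p i].
Proof.
move=> w0 /(normal_action w0) [a [c [a0 c0 wx wy wt]]]; set n := odeg w in wx wy.
have coefx m : ocoef w m * iter m s xA = a *: (iter n s xA * ocoef w m).
  by rewrite -ocoef_constr -ocoef_constl -ocoefZ -wx.
have coefy m : ocoef w m * iter m s yA = a *: (iter n s yA * ocoef w m).
  by rewrite -ocoef_constr -ocoef_constl -ocoefZ -wy.
have parity m : odd m != odd n -> ocoef w m = 0.
  move=> mn; apply: (no_crossing _ a0); move: (coefx m); rewrite !iter_pswap_x.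
  by case: (odd m) (odd n) mn => [] [] //= _; [right | left].
have [n_odd|n_even] := boolP (odd n).
  by constructor 1; apply: ovar_factor; rewrite parity // n_odd.
have wm m : ~~ odd m -> ocoef w m * xA = a *: (xA * ocoef w m) /\
    ocoef w m * yA = a *: (yA * ocoef w m).
  move=> /negPf m_even; have := coefx m; have := coefy m.
  by rewrite !iter_pswap_x !iter_pswap_y (negPf n_even) m_even.
have [a1|a1] := eqVneq a 1; last first.
  constructor 2.
  (* The right factor [y] of the product reaches the [m]-th coefficient as [iter m s yA]. For odd
     [m] the coefficient is zero, hence the witness 0. *)
  have /choice[f fE] : forall m, exists v, ocoef w m = xA * v * iter m s yA.
    move=> m; have [m_odd|m_even] := boolP (odd m).
      by exists 0; rewrite mulr0 mul0r parity // m_odd (negPf n_even).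
    have [wmx wmy] := wm m m_even; have [v vE] := p_twisted a1 wmx wmy.
    by exists v; rewrite iter_pswap_y (negPf m_even).
  pose z : D := \poly_(m < size (w : {poly A})) f m.
  have zE m : ocoef z m = if (m < size (w : {poly A}))%N then f m else 0.
    exact: coef_poly.
  exists z; apply: ore_ext => m; rewrite ocoef_constr ocoef_constl zE.
  case: ltnP => [_|wm0]; first exact: fE.
  by rewrite mulr0 mul0r /ocoef nth_default.
constructor 3; exists c => //.
have wC u : w * oconst s u = oconst s u * w.
  elim/p_ind: u => [e|||u v IH IH'|u v IH IH'].
  - by rewrite rmorph_alg mulr_algl mulr_algr.
  - by rewrite [LHS]wx a1 scale1r iter_pswap_x (negPf n_even).
  - by rewrite [LHS]wy a1 scale1r iter_pswap_y (negPf n_even).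
  - by rewrite rmorphD mulrDr mulrDl IH IH'.
  - by rewrite rmorphM mulrA IH -mulrA IH' mulrA.
elim/ore_ind => [p p' [q [wp qE]] [q' [wp' qE']]|u m].
  exists (q + q'); split=> [|i]; first by rewrite mulrDr mulrDl wp wp'.
  by rewrite !ocoefD scalerDr qE qE'.
exists (c ^+ m *: omono s u m); split=> [|i]; last first.
  by rewrite ocoefZ ocoef_mono; case: eqP => [->|]; rewrite ?scaler0.
have tm : w * dt ^+ m = c ^+ m *: (dt ^+ m * w).
  elim: m => [|m IH]; first by rewrite mulr1 mul1r scale1r.
  rewrite exprSr mulrA IH -scalerAl -[_ * w * dt]mulrA wt -scalerAr scalerA.
  by rewrite mulrA [c ^+ m.+1]exprSr.
by rewrite omonoE mulrA wC -mulrA tm -scalerAr mulrA -scalerAl.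
Qed.

Lemma normal_gen (w : D) : (exists b, w * dx = b * w) ->
  (exists b, w * dy = b * w) -> (exists b, w * dt = b * w) -> normal w.
Proof.
move=> wx wy wt; elim/oreD_ind => [c||||a b [a' wa] [b' wb]|a b [a' wa] [b' wb]] //.
- by exists c%:A; rewrite mulr_algl mulr_algr.
- by exists (a' + b'); rewrite mulrDr mulrDl wa wb.
- by exists (a' * b'); rewrite mulrA wa -mulrA wb mulrA.
Qed.

Lemma normal_dt : normal dt.
Proof.
by apply: normal_gen; [exists dy; exact: d_tx | exists dx; exact: d_ty | exists dt].
Qed.

(** Conjugation by [x y] negates each of the three generators. *)
Lemma normal_dxy : normal (dx * dy).
Proof.
apply: normal_gen.
- by exists (- dx); rewrite -mulrA -[dy * dx]opprK -d_xy mulrN mulNr.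
- by exists (- dy); rewrite {1}d_xy !mulNr mulrA.
- by exists (- dt); rewrite mulNr mulrA d_tx -[dy * dt * dy]mulrA d_ty mulrA -mulNr -d_xy.
Qed.

(** * Units and the irreducibility of t *)

Lemma pdeg_1 : degA 1 = 0.
Proof.
have one0 : (1 : A) != 0 := oner_neq0 _.
have := pdegM one0 one0; rewrite mulr1 => /eqP.
by rewrite -[X in X == _]addn0 eqn_add2l eq_sym => /eqP.
Qed.

Lemma plane_unit (u v : A) : u * v = 1 ->
  (exists c : k, u = c%:A) /\ (exists c : k, v = c%:A).
Proof.
move=> uv1; have : u * v != 0 by rewrite uv1 oner_neq0.
have [->|u0] := eqVneq u 0; first by rewrite mul0r eqxx.
have [->|v0 _] := eqVneq v 0; first by rewrite mulr0 eqxx.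
have := pdeg_1; rewrite -{1}uv1 pdegM // => /eqP; rewrite addn_eq0.
move=> /andP[/eqP du /eqP dv].
have : (degA (s u) + degA (s v) == 0)%N.
  by rewrite -pdegM ?pswap_eq0 // -rmorphM uv1 rmorph1 pdeg_1.
rewrite addn_eq0 => /andP[/eqP dsu /eqP dsv].
by split; [exact: p_scalar du dsu | exact: p_scalar dv dsv].
Qed.

Lemma scalar_const (c : k) : c%:A = oconst s c%:A.
Proof. by rewrite rmorph_alg. Qed.

(** One factor has [t]-degree 0 and the other 1. The coefficient of [t] is then 1, a product in the
    plane, which forces the factor of degree 0 to be a scalar. *)
Lemma dt_irreducible (p q : D) : dt = p * q ->
  (exists c : k, p = c%:A) \/ (exists c : k, q = c%:A).
Proof.
move=> tpq; have := dt_neq0; rewrite tpq.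
have [->|p0] := eqVneq p 0; first by rewrite mul0r eqxx.
have [->|q0 _] := eqVneq q 0; first by rewrite mulr0 eqxx.
have := congr1 (@odeg _ _ _) tpq; rewrite ddegM // odeg_dt.
case dp : (odeg p) => [|m] dpq.
  left; have pE := odeg0_const dp; have := congr1 (fun p => ocoef p 1) tpq.
  rewrite {1}pE ocoef_constl ocoef_mono => /esym/plane_unit[[c cE] _].
  by exists c; rewrite pE cE rmorph_alg.
right; move/eqP: dpq; rewrite addSn eqSS eq_sym addn_eq0.
move=> /andP[/eqP m0 /eqP dq]; rewrite m0 in dp.
have qE := odeg0_const dq; have := congr1 (fun p => ocoef p 1) tpq.
rewrite {1}qE ocoef_constr ocoef_mono /= => /esym/plane_unit[_ [c cE]].
by exists c; rewrite qE -[ocoef q 0]pswapK cE !rmorph_alg.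
Qed.

Lemma oreD_unit (p q : D) : p * q = 1 -> exists c : k, q = c%:A.
Proof.
move=> pq1; have : p * q != 0 by rewrite pq1 oner_neq0.
have [->|p0] := eqVneq p 0; first by rewrite mul0r eqxx.
have [->|q0 _] := eqVneq q 0; first by rewrite mulr0 eqxx.
have : (odeg p + odeg q == 0)%N.
  by rewrite -ddegM // pq1 -(rmorph1 (oconst s)) odeg_const.
rewrite addn_eq0 => /andP[/eqP/odeg0_const pE /eqP/odeg0_const qE].
have : ocoef p 0 * ocoef q 0 = 1.
  apply: (@oconst_inj _ _ s).
  by rewrite rmorphM rmorph1 /= -pE -qE.
by move=> /plane_unit[_ [c cE]]; exists c; rewrite qE cE rmorph_alg.
Qed.

Lemma dy_nonscalar (c : k) : dy != c%:A.
Proof.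
apply/eqP; rewrite scalar_const => /oconst_inj yc; have := pdeg_y pl; rewrite yc.
have [c0|c0] := eqVneq c 0; last by rewrite pdegZ // pdeg_1.
by have := py_neq0 pl; rewrite yc c0 scale0r eqxx.
Qed.

Lemma dx_nonscalar (c : k) : dx != c%:A.
Proof.
apply/eqP; rewrite scalar_const => /oconst_inj xc.
have /eqP[] := dy_nonscalar c; rewrite scalar_const; congr oconst.
by rewrite -pswap_x xc rmorph_alg.
Qed.

Lemma dt_nonscalar (c : k) : dt != c%:A.
Proof.
by apply/eqP; rewrite scalar_const => /(congr1 (@odeg _ _ _)); rewrite odeg_dt odeg_const.
Qed.

(** * Images of the generators under an automorphism *)

Section Automorphism.
Hypothesis char2 : 2%:R != 0 :> k.
Variables f g : alg_aut D.
Hypotheses (fK : cancel f g) (gK : cancel g f).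

Lemma normal_aut w : normal w -> normal (f w).
Proof.
move=> wN a; have [b wb] := wN (g a); exists (f b).
by rewrite -{1}[a]gK -!rmorphM wb.
Qed.

Lemma aut_eq0 w : (f w == 0) = (w == 0).
Proof.
apply/eqP/eqP => [fw|->]; last exact: rmorph0.
by rewrite -[w]fK fw rmorph0.
Qed.

Lemma aut_nonscalar p : (forall c : k, p != c%:A) -> forall c : k, g p != c%:A.
Proof.
move=> pc c; apply/eqP => gpc; have /eqP[] := pc c.
by rewrite -[p]gK gpc rmorph_alg.
Qed.

Lemma aut_dt : exists2 b : k, b != 0 & f dt = b *: dt.
Proof.
have ft0 : f dt != 0 by rewrite aut_eq0 dt_neq0.
case: (normal_cases ft0 (normal_aut normal_dt)) => [[w ftw]|[z ftz]|[c c0 tC]].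
(* Pulled back by [g], the factorization is one of [t]; since [g t] is not a scalar, [g w] is. *)
- have tE : dt = g w * g dt by rewrite -rmorphM /= -ftw fK.
  case: (dt_irreducible tE) => -[c cE]; last first.
    by have := aut_nonscalar dt_nonscalar c; rewrite cE eqxx.
  exists c; last by rewrite ftw -[w]gK cE rmorph_alg mulr_algl.
  by apply: contra_neq ft0 => c0; rewrite ftw -[w]gK cE c0 scale0r rmorph0 mul0r.
(* Irreducibility makes [z y] a scalar, nonzero since [f t] is; then [y] would be invertible, hence
   a scalar. *)
- have tE : dt = g dx * g (z * dy) by rewrite -rmorphM /= mulrA -ftz fK.
  case: (dt_irreducible tE) => -[c cE].
    by have := aut_nonscalar dx_nonscalar c; rewrite cE eqxx.
  have zy : z * dy = c%:A by rewrite -[LHS]gK cE rmorph_alg.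
  have [c0|c0] := eqVneq c 0.
    by move: ft0; rewrite ftz -mulrA zy c0 scale0r mulr0 eqxx.
  have [|e eE] := @oreD_unit (c^-1 *: z) dy.
    by rewrite -scalerAl zy scalerA mulVf // scale1r.
  by have := dy_nonscalar e; rewrite eE eqxx.
(* Since [t x = y t], the conjugate of [f x] by [f t] is [f y], so [f y] has the coefficients of
   [f x] rescaled by powers of [c]. *)
have [q [tq qE]] := tC (f dx); have fyq : f dy = q.
  by apply: (oreD_mulIr ft0); rewrite /= -tq -!rmorphM d_tx.
set p := f dx in qE *; have p0 : p != 0 by rewrite aut_eq0 dx_neq0.
have pq : p * q = - (q * p) by rewrite -fyq -rmorphM d_xy rmorphN rmorphM.
have cn0 : c ^+ odeg p != 0 by rewrite expf_neq0.
have dq : odeg q = odeg p.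
  apply: odeg_eq => [|m pm]; rewrite qE.
    by rewrite scaler_eq0 negb_or cn0 olead_eq0.
  by rewrite ocoef_gt ?scaler0.
have q0 : q != 0 by rewrite -fyq aut_eq0 dy_neq0.
have lq : olead q = c ^+ odeg p *: olead p by rewrite /olead dq qE.
(* The top coefficients of [p q] and [q p] are the same nonzero element, [c ^+ odeg p] times the
   leading coefficient of [p * p], so they cannot be opposite. *)
have := congr1 (fun u => ocoef u (odeg p + odeg p)) pq.
have := ocoefM_top p q; have := ocoefM_top q p; rewrite dq lq => qpE pqE.
rewrite ocoefN qpE pqE iter_linearZ.
rewrite -scalerAr -scalerAl => /(opp_eq0 char2)/eqP; rewrite scaler_eq0 (negPf cn0) /=.
by rewrite (negPf (olead_mul_neq0 swap_inj (@p_domain _ pl) p0 p0)).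
Qed.
End Automorphism.

Section AutomorphismXY.
Hypothesis char2 : 2%:R != 0 :> k.

(** The inverse also sends [t] to a multiple of [t], so a right factor [t] of [f p] pulls back to
    one of [p]. *)
Lemma aut_dt_factor (f g : alg_aut D) (p w : D) :
  cancel f g -> cancel g f -> p != 0 -> f p = w * dt -> odeg p != 0.
Proof.
move=> fK gK p0 fp; have [b b0 gt] := aut_dt char2 gK fK.
have pE : p = b *: (g w * dt).
  by rewrite -[LHS]fK fp rmorphM /= gt -scalerAr.
have gw0 : g w != 0.
  by apply: contra_neq p0 => gw; rewrite pE gw mul0r scaler0.
by rewrite pE odegZ // ddegM ?dt_neq0 // odeg_dt addn1.
Qed.

Lemma aut_dxy (f g : alg_aut D) : cancel f g -> cancel g f ->
  exists z, f dx * f dy = dx * z * dy.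
Proof.
move=> fK gK; have dxy0 : dx * dy != 0 by rewrite oreD_mul_neq0 ?dx_neq0 ?dy_neq0.
have fxy0 : f (dx * dy) != 0 by rewrite (aut_eq0 fK).
case: (normal_cases fxy0 (normal_aut gK normal_dxy)) => [[w fw]|[z fz]|[c c0 C]].
- have := aut_dt_factor fK gK dxy0 fw.
  by rewrite ddegM ?dx_neq0 ?dy_neq0 // odeg_dx odeg_dy.
- by exists z; rewrite -fz rmorphM.
(* Conjugation by [f (x y)] negates [f x] but fixes its constant coefficient, as [c ^+ 0 = 1]. So
   that coefficient vanishes and [f x] has a factor [t], although [x] has [t]-degree 0. *)
have [q [xyq qE]] := C (f dx).
have qN : q = - f dx.
  apply: (oreD_mulIr fxy0); rewrite /= -xyq mulNr -rmorphM.
  by rewrite -mulrA -[dy * dx]opprK -d_xy mulrN rmorphN rmorphM.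
have x0 : ocoef (f dx) 0 = 0.
  apply: (opp_eq0 char2); have := qE 0%N.
  by rewrite scale1r qN ocoefN => ->.
have [w fxw] := ovar_factor x0.
by have := aut_dt_factor fK gK dx_neq0 fxw; rewrite odeg_dx.
Qed.

Lemma aut_classification (f : alg_aut D) : exists a b : k,
  [/\ a != 0, b != 0, f dt = b *: dt &
    f dx = a *: dx /\ f dy = a *: dy \/ f dx = a *: dy /\ f dy = a *: dx].
Proof.
have [g [fK gK]] := aut_has_inv f.
have [b b0 ft] := aut_dt char2 fK gK.
(* The factorization is taken for the inverse [g] and pushed forward by [f], so that [f x] and [f y]
   become factors of [x y]. *)
have [z gz] := aut_dxy gK fK.
have xyE : dx * dy = f dx * f z * f dy.
  by have := congr1 f gz; rewrite !rmorphM /= !gK.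
have dxy0 : dx * dy != 0 by rewrite oreD_mul_neq0 ?dx_neq0 ?dy_neq0.
have fx0 : f dx != 0 by rewrite (aut_eq0 fK) dx_neq0.
have fy0 : f dy != 0 by rewrite (aut_eq0 fK) dy_neq0.
have fz0 : f z != 0.
  by apply: contra_neq dxy0 => fz; rewrite xyE fz mulr0 mul0r.
have /eqP := congr1 (@odeg _ _ _) xyE.
rewrite !ddegM ?oreD_mul_neq0 ?dx_neq0 ?dy_neq0 // odeg_dx odeg_dy eq_sym.
rewrite !addn_eq0 => /andP[/andP[/eqP/odeg0_const fxE /eqP/odeg0_const fzE]].
move=> /eqP/odeg0_const fyE.
set u := ocoef (f dx) 0 in fxE; set v := ocoef (f z) 0 in fzE.
set u' := ocoef (f dy) 0 in fyE.
(* This is the image of [t x = y t], with the scalar [b] cancelled. *)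
have u'E : u' = s u.
  have := congr1 f d_tx; rewrite !rmorphM /= ft fxE fyE.
  rewrite -scalerAl -scalerAr ovar_const => /(scalerI b0)/(oreD_mulIr dt_neq0).
  by move/oconst_inj.
have uv : xA * yA = u * v * u'.
  by apply: (@oconst_inj _ _ s); rewrite !rmorphM /= -fxE -fzE -fyE.
have nz (q : A) (p : D) : p != 0 -> p = oconst s q -> q != 0.
  by move=> p0 pq; apply: contra_neq p0 => q0; rewrite pq q0 rmorph0.
have u0 := nz _ _ fx0 fxE; have v0 := nz _ _ fz0 fzE; have u'0 := nz _ _ fy0 fyE.
have mul0 (p q : A) : p != 0 -> q != 0 -> p * q != 0.
  by move=> p0 q0; apply/eqP => /p_domain[] /eqP; apply/negP.
(* In [x y = u v s(u)] the degree in [y] is 1, and the degree in [y] of [s u] is the degree in [x]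
   of [u]. *)
have degu : (degA u + degA (s u) <= 1)%N.
  have := congr1 degA uv; rewrite !pdegM ?mul0 ?px_neq0 ?py_neq0 //.
  rewrite pdeg_x pdeg_y u'E => E.
  by rewrite -[1%N]add0n E leq_add2r leq_addr.
have anti : u * u' = - (u' * u).
  apply: (@oconst_inj _ _ s); rewrite rmorphN !rmorphM /= -fxE -fyE.
  by rewrite -rmorphM d_xy rmorphN rmorphM.
have main w : degA w = 0 -> degA (s w) = 1 ->
    w * s w = - (s w * w) -> exists2 a : k, a != 0 & w = a *: xA.
  move=> w0 w1 ww; have [a a0 [c wE]] := p_affine w0 w1.
  have swE : s w = a *: yA + c%:A.
    by rewrite wE rmorphD /= linearZ_LR rmorph_alg /= pswap_x.
  have [c0 _] : c = 0 /\ c = 0.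
    by apply: (@p_affine_anti _ pl _ _ _ _ a0 a0); rewrite -wE -swE.
  by exists a => //; rewrite wE c0 scale0r addr0.
(* Degrees (0, 0) would make [f x] a scalar. The other two possibilities give a multiple of [x] or,
   applying [main] to [s u], a multiple of [y]. *)
case du : (degA u) => [|m].
  case dsu : (degA (s u)) => [|m].
    have [c cE] := p_scalar du dsu.
    have := aut_nonscalar fK dx_nonscalar c.
    by rewrite fxE cE rmorph_alg eqxx.
  have m0 : m = 0 by move: degu; rewrite du dsu; case: m {dsu}.
  rewrite m0 in dsu; rewrite u'E in anti; have [a a0 uE] := main u du dsu anti.
  exists a, b; split=> //; left.
  by rewrite fxE fyE u'E uE !linearZ_LR /= pswap_x.
move: degu; rewrite du addSn ltnS leqn0 addn_eq0 => /andP[/eqP m0 /eqP dsu].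
rewrite m0 in du; rewrite u'E in anti.
have [||a a0 uE] := main (s u) dsu; rewrite ?pswapK //.
  by rewrite anti opprK.
exists a, b; split=> //; right.
by rewrite fxE fyE u'E -[u in LHS]pswapK uE !linearZ_LR /= pswap_x.
Qed.
End AutomorphismXY.
End OreModel.

(** * The automorphism group of S *)

Lemma aut_of_iso (k : fieldType) (A : algType k) (f : {lrmorphism A -> A})
  (g : A -> A) : cancel f g -> cancel g f -> exists h : alg_aut A, h =1 f.
Proof.
move=> fK gK; have fP : `[< is_alg_aut f >].
  apply/asboolP; split; [exact: linearP | | by exists g].
  by split; [exact: rmorph1 | exact: rmorphM].
by exists (AlgAut fP).
Qed.

Lemma cyclic_involution (G : groupType) (g : G) (h : cyclic_grp g) :
  (g * g = 1)%g -> cyc_val h = 1%g \/ cyc_val h = g.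
Proof.
move=> g2; have gn n : (g ^+ n)%g = 1%g \/ (g ^+ n)%g = g.
  elim: n => [|n [] IH]; first by left.
    by right; rewrite expgS IH mulg1.
  by left; rewrite expgS IH g2.
have gV : (g^-1)%g = g by apply: (mulgI g); rewrite mulgV g2.
case: h => h /= /asboolP[n [->|->]]; first exact: gn.
by case: (gn n) => ->; rewrite ?invg1 ?gV; [left | right].
Qed.

(** The swap commutes with every scaling, because [x] and [y] are scaled by the same factor; the
    semidirect product is therefore built on this action. *)
Definition trivial_action (H N : groupType) : group_action H N :=
  @GroupAction H N (fun _ n => n) (fun _ => erefl) (fun _ _ _ => erefl)
    (fun _ _ _ => erefl).

(** * Algebras with the universal property of the presentation *)

Section PresentedAlgebra.
Variables (k : fieldType) (S : algType k) (x y t : S).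
Hypotheses (rel_xy : x * y = - (y * x)) (rel_tx : t * x = y * t)
  (rel_ty : t * y = x * t).
Hypothesis lift : forall (B : algType k) (u v w : B),
  u * v = - (v * u) -> w * u = v * w -> w * v = u * w ->
  exists f : {lrmorphism S -> B}, [/\ f x = u, f y = v & f t = w].
Hypothesis ext : forall (B : algType k) (f g : {lrmorphism S -> B}),
  f x = g x -> f y = g y -> f t = g t -> f =1 g.

Lemma presented_aut_ext (f g : alg_aut S) : f x = g x -> f y = g y -> f t = g t -> f = g.
Proof.
by move=> fx fy ft; apply: alg_aut_ext; exact: ext.
Qed.

Section ViaOreModel.
Variable pl : skew_plane k.
Local Notation dx := (dx pl).
Local Notation dy := (dy pl).
Local Notation dt := (dt pl).

(** Both algebras satisfy the relations and the universal property, so the two induced morphisms are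
    mutually inverse. This transfers the classification and the linear independence facts from the
    Ore model. *)
Lemma presented_iso : exists (h : {lrmorphism S -> ore (pswap pl)})
    (h' : {lrmorphism ore (pswap pl) -> S}),
  [/\ cancel h h', cancel h' h, h x = dx, h y = dy & h t = dt].
Proof.
have [h [hx hy ht]] := lift (d_xy pl) (d_tx pl) (d_ty pl).
have [h' [hx' hy' ht']] := oreD_lift pl (rel_xy) (rel_tx) (rel_ty).
exists h, h'; split=> //.
  by apply: (ext (f := h' \o h) (g := idfun)) => /=; rewrite ?hx ?hy ?ht.
by apply: (oreD_mext (f := h \o h') (g := idfun)) => /=; rewrite ?hx' ?hy' ?ht'.
Qed.

Lemma presented_aut_classification (f : alg_aut S) : 2%:R != 0 :> k -> exists a b : k,
  [/\ a != 0, b != 0, f t = b *: t &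
    f x = a *: x /\ f y = a *: y \/ f x = a *: y /\ f y = a *: x].
Proof.
move=> char2; have [h [h' [hK h'K hx hy ht]]] := presented_iso.
have hx' : h' dx = x by rewrite -hx hK.
have hy' : h' dy = y by rewrite -hy hK.
have ht' : h' dt = t by rewrite -ht hK.
have [g [fK gK]] := aut_has_inv f.
have [|u|F FE] := @aut_of_iso _ _ (h \o f \o h') (h \o g \o h').
- by move=> u /=; rewrite hK fK h'K.
- by rewrite /= hK gK h'K.
have fE u : f u = h' (F (h u)) by rewrite FE /= !hK.
have [a [b [a0 b0 Ft Fxy]]] := aut_classification char2 F.
exists a, b; split=> //; first by rewrite fE ht Ft linearZ_LR /= ht'.
by case: Fxy => -[Fx Fy]; [left | right];
   rewrite !fE hx hy Fx Fy !linearZ_LR /= hx' hy'.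
Qed.

(** In the model, [x] and [y] have different degrees in [y]. This separates scalings from their
    composites with the swap and gives [tau != 1]. *)
Lemma presented_gens_free :
  [/\ x != 0, t != 0 & forall a b : k, a != 0 -> a *: x != b *: y].
Proof.
have [h [h' [hK _ hx hy ht]]] := presented_iso.
have nz u : h u != 0 -> u != 0.
  by apply: contra_neq => ->; rewrite rmorph0.
split; [apply: nz; rewrite hx; exact: dx_neq0 | apply: nz; rewrite ht; exact: dt_neq0 |].
move=> a b a0; apply/eqP => /(congr1 h); rewrite !linearZ_LR /= hx hy.
move/(congr1 (fun u => ocoef u 0)); rewrite !ocoefZ !ocoef_const /= => xy.
have := pdegZ (px pl) a0; rewrite xy pdeg_x.
have [b0|b0] := eqVneq b 0; last by rewrite pdegZ // pdeg_y.
move/eqP: xy; rewrite b0 scale0r scaler_eq0 (negPf a0) /= => /eqP x0.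
by have := px_neq0 pl; rewrite x0 eqxx.
Qed.

End ViaOreModel.

(** * Scalings, the swap, and the group isomorphism *)

Fact scaling_exists (a b : k) : exists f : {lrmorphism S -> S},
  [/\ f x = a *: x, f y = a *: y & f t = b *: t].
Proof.
apply: lift; rewrite -!scalerAl -!scalerAr.
- by rewrite rel_xy !scalerN.
- by rewrite rel_tx !scalerA mulrC.
- by rewrite rel_ty !scalerA mulrC.
Qed.

Fact scaling_aut_exists (n : units k * units k) : exists f : alg_aut S,
  [/\ f x = unit_val n.1 *: x, f y = unit_val n.1 *: y & f t = unit_val n.2 *: t].
Proof.
case: n => a b /=; have a0 : unit_val a != 0 by rewrite -unitfE; exact: (valP a).
have b0 : unit_val b != 0 by rewrite -unitfE; exact: (valP b).
have [f [fx fy ft]] := scaling_exists (unit_val a) (unit_val b).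
have [g [gx gy gt]] := scaling_exists (unit_val a)^-1 (unit_val b)^-1.
have [||h hE] := @aut_of_iso _ _ f g; last by exists h; rewrite !hE.
  apply: (ext (f := g \o f) (g := idfun));
  by rewrite /= ?fx ?fy ?ft linearZ_LR /= ?gx ?gy ?gt scalerA mulfV ?scale1r.
apply: (ext (f := f \o g) (g := idfun));
by rewrite /= ?gx ?gy ?gt linearZ_LR /= ?fx ?fy ?ft scalerA mulVf ?scale1r.
Qed.
Definition scaling_aut n := projT1 (cid (scaling_aut_exists n)).

Lemma scaling_autE n : [/\ scaling_aut n x = unit_val n.1 *: x,
  scaling_aut n y = unit_val n.1 *: y & scaling_aut n t = unit_val n.2 *: t].
Proof. by rewrite /scaling_aut; case: cid. Qed.

Lemma scaling_autM n n' : scaling_aut (n * n')%g = (scaling_aut n * scaling_aut n')%g.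
Proof.
have [mx my mt] := scaling_autE (n * n')%g; have [nx ny nt] := scaling_autE n.
have [nx' ny' nt'] := scaling_autE n'.
by apply: presented_aut_ext; rewrite ?mx ?my ?mt /= ?nx' ?ny' ?nt' linearZ_LR /=
  ?nx ?ny ?nt scalerA mulrC.
Qed.

Fact tau_exists : exists tau : alg_aut S, [/\ tau x = y, tau y = x & tau t = t].
Proof.
have [||| f [fx fy ft]] := @lift S y x t.
- by rewrite rel_xy opprK.
- exact: rel_ty.
- exact: rel_tx.
have fK : involutive f.
  by apply: (ext (f := f \o f) (g := idfun)); rewrite /= ?fx ?fy ?ft ?fx ?fy.
have [h hE] := aut_of_iso fK fK; by exists h; rewrite !hE.
Qed.
Definition tau := projT1 (cid tau_exists).
Lemma tauE : [/\ tau x = y, tau y = x & tau t = t].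
Proof. by rewrite /tau; case: cid. Qed.

Lemma tau2 : (tau * tau = 1)%g.
Proof.
by have [tx ty tt] := tauE; apply: presented_aut_ext; rewrite /= ?tx ?ty ?tt ?tx ?ty.
Qed.

Lemma scaling_tau n : (tau * scaling_aut n = scaling_aut n * tau)%g.
Proof.
have [tx ty tt] := tauE; have [nx ny nt] := scaling_autE n.
by apply: presented_aut_ext; rewrite /= ?tx ?ty ?tt ?nx ?ny ?nt linearZ_LR /= ?tx ?ty ?tt.
Qed.
(** The isomorphism sends [(n, h)] to the scaling by [n] composed with [h]. It is multiplicative
    because [h] commutes with scalings, and surjective by the classification. *)
Lemma presented_aut : 2%:R != 0 :> k ->
  exists tau : alg_aut (S),
    [/\ tau (x) = y, tau (y) = x & tau (t) = t] /\
    (tau != 1%g /\ (tau ^+ 2)%g = 1%g) /\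
    exists (theta : group_action (cyclic_grp tau) (units k * units k)%type)
           (Phi : {multiplicative semidirect theta -> alg_aut (S)}),
      [/\ bijective Phi,
          forall h : cyclic_grp tau, Phi (Semidirect theta 1%g h) = cyc_val h
        & forall a b : units k,
            let phi := Phi (Semidirect theta (a, b) 1%g) in
            [/\ phi (x) = unit_val a *: x,
                phi (y) = unit_val a *: y
              & phi (t) = unit_val b *: t]].
Proof.
move=> char2.
have [x0 t0 xy] := presented_gens_free (skew_plane_model char2).
have [tx ty tt] := tauE.
exists tau; split=> //; split.
  split; last by rewrite expgS expg1 tau2.
  apply/eqP => tau1; have := xy 1 1 (oner_neq0 _).
  by rewrite !scale1r -[in X in _ != X]tx tau1 eqxx.
pose theta := trivial_action (cyclic_grp tau) (units k * units k)%type.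
pose P (u : semidirect theta) : alg_aut (S) :=
  (scaling_aut (sd_left u) * cyc_val (sd_right u))%g.
have commP (h : cyclic_grp tau) n :
    (cyc_val h * scaling_aut n = scaling_aut n * cyc_val h)%g.
  case: (cyclic_involution h (tau2)) => ->; first by rewrite mul1g mulg1.
  exact: scaling_tau.
have PM : {morph P : u v / (u * v)%g}.
  case=> n h [n' h']; rewrite /P /= scaling_autM -!mulgA; congr (_ * _)%g.
  by rewrite !mulgA commP.
pose Phi : {multiplicative semidirect theta -> alg_aut (S)} :=
  HB.pack P (isMultiplicative.Build _ _ P PM).
have s1 : scaling_aut (1%g : (units k * units k)%type) = 1%g.
  have [sx sy st] := scaling_autE (1%g : (units k * units k)%type).
  by apply: presented_aut_ext; rewrite ?sx ?sy ?st /= scale1r.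
exists theta, Phi; split; last first.
- by move=> a b; exact: (scaling_autE (a, b)).
- by move=> h; rewrite /= /P /= s1 mul1g.
(* The image of [t] determines [b], since [tau] fixes [t]. The image of [x] determines both [a] and
   whether the swap occurs. *)
have Pinj : injective P.
  case=> [[a b] h] [[a' b'] h'] PE.
  have [sx sy st] := scaling_autE (a, b); have [sx' sy' st'] := scaling_autE (a', b').
  have cyct (h0 : cyclic_grp tau) : cyc_val h0 (t) = t.
    by case: (cyclic_involution h0 (tau2)) => ->.
  have scI (u : S) (c d : k) : u != 0 -> c *: u = d *: u -> c = d.
    move=> u0 /eqP; rewrite -subr_eq0 -scalerBl scaler_eq0 (negPf u0) orbF subr_eq0.
    by move/eqP.
  have bb : b = b'.
    apply/val_inj/(scI (t)) => //.
    by have := congr1 (fun f : alg_aut _ => f (t)) PE; rewrite /P /= !cyct st st'.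
  have a0 (c : units k) : unit_val c != 0 by rewrite -unitfE; exact: (valP c).
  have := congr1 (fun f : alg_aut _ => f (x)) PE; rewrite /P /=.
  have y0 : y != 0 by apply: contra_neq x0 => y0; rewrite -ty y0 rmorph0.
  have hE (h0 h1 : cyclic_grp tau) : cyc_val h0 = cyc_val h1 -> h0 = h1.
    exact: val_inj.
  case: (cyclic_involution h (tau2)) => hv;
  case: (cyclic_involution h' (tau2)) => hv';
  rewrite hv hv' /= ?tx ?sx ?sx' ?sy ?sy'.
  - by move=> /(scI _ _ _ x0) /= /val_inj ->; rewrite bb (hE h h') ?hv ?hv'.
  - by move/eqP; rewrite (negPf (xy _ _ _)).
  - by move/esym/eqP; rewrite (negPf (xy _ _ _)).
  - by move=> /(scI _ _ _ y0) /= /val_inj ->; rewrite bb (hE h h') ?hv ?hv'.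
have Psurj f : exists u, P u = f.
  have [a [b [a0 b0 ft fxy]]] :=
    presented_aut_classification (skew_plane_model char2) f char2.
  rewrite -!unitfE in a0 b0.
  have [sx sy st] := scaling_autE (Units a0, Units b0).
  have tauC : cyclic_pred tau tau by apply/asboolP; exists 1%N; left.
  case: fxy => -[fx fy].
    exists (Semidirect theta (Units a0, Units b0) 1%g).
    by apply: presented_aut_ext; rewrite /P /= ?sx ?sy ?st ?fx ?fy ?ft.
  exists (Semidirect theta (Units a0, Units b0) (CyclicGrp tauC)).
  by apply: presented_aut_ext; rewrite /P /= ?tx ?ty ?tt ?sx ?sy ?st ?fx ?fy ?ft.
have [Q QK] := choice Psurj.
by exists Q => // u; apply: Pinj; rewrite QK.
Qed.
End PresentedAlgebra.

Theorem proposition8p2 (k : closedFieldType) (char0 : [pchar k] =i pred0) :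
  exists tau : alg_aut (algS k),
    [/\ tau (Sx k) = Sy k, tau (Sy k) = Sx k & tau (St k) = St k] /\
    (tau != 1%g /\ (tau ^+ 2)%g = 1%g) /\
    exists (theta : group_action (cyclic_grp tau) (units k * units k)%type)
           (Phi : {multiplicative semidirect theta -> alg_aut (algS k)}),
      [/\ bijective Phi,
          forall h : cyclic_grp tau, Phi (Semidirect theta 1%g h) = cyc_val h
        & forall a b : units k,
            let phi := Phi (Semidirect theta (a, b) 1%g) in
            [/\ phi (Sx k) = unit_val a *: Sx k,
                phi (Sy k) = unit_val a *: Sy k
              & phi (St k) = unit_val b *: St k]].
Proof.
apply: (presented_aut (S_rel_xy k) (S_rel_tx k) (S_rel_ty k) (@S_lift k) (@S_ext k)).
(* As 2 is prime and no prime is a characteristic of [k], 2 is nonzero in [k]. *)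
by have := char0 2; rewrite !inE /= => ->.
Qed.
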